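(* Let $f\colon\mathbb{R}^n\to\mathcal{G}_{2n}$ be continuous and integrable. Assume that the inverse Clifford-Fourier transform $$(f\mathcal{F}_o^{-1})(x)=\int_{\mathbb{R}^n}f(t)e^{I(x,t)}\,dm(t)$$ is integrable on $\mathbb{R}^n$, and that for all $\underline{y}=y+y'\in\mathbb{R}^{2n}$ the functions $x\mapsto e^{-(x,y')}(f\mathcal{F}_o^{-1})(x)$ and $x\mapsto x_i e^{-(x,y')}(f\mathcal{F}_o^{-1})(x)$, $i=1,\dots,n$, are integrable on $\mathbb{R}^n$. Then the function $$\underline{y}\mapsto((f\mathcal{F}_o^{-1})\mathbf{F}_2)(\underline{y})$$ is a right-monogenic extension of $f$ to all of $\mathbb{R}^{2n}$; that is, it is right-monogenic in $\mathbb{R}^{2n}$ and its restriction to $\mathbb{R}^n\subseteq\mathbb{R}^{2n}$ equals $f$.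
   Context: $\mathcal{G}_{2n}$ is the real Clifford algebra generated by an orthonormal basis $e_1,\dots,e_n,e'_1,\dots,e'_n$ of $\mathbb{R}^{2n}$, with $v^2=v\cdot v$ for all vectors $v$ (so basis vectors square to $1$ and distinct basis vectors anticommute). $\mathbb{R}^n$ is identified with the span of $e_1,\dots,e_n$ in $\mathbb{R}^{2n}$. The norm is $|A|^2=\sum_I\alpha_I^2$ for $A=\sum_I\alpha_I e_I$ in the standard basis of ordered products of basis vectors. Put $B_i=e_ie'_i$; then $B_i^2=-1$ and $B_iB_j=B_jB_i$. The measure is $dm(x)=(2\pi)^{-n/2}dx$ on $\mathbb{R}^n$, with $dx$ Lebesgue measure. For $x,y\in\mathbb{R}^n$, $I(x,y)=\sum_{i=1}^n B_ix_iy_i$. For $\underline{y}\in\mathbb{R}^{2n}$ write $\underline{y}=y+y'$ with $y=\sum_i y_ie_i$ and $y'=\sum_i y'_ie'_i$, let $(x,y')=\sum_i x_iy'_i$, and set $I(\underline{y},x)=I(x,y)+(x,y')$. For $g\colon\mathbb{R}^n\to\mathcal{G}_{2n}$, $$(g\mathbf{F}_2)(\underline{y})=\int_{\mathbb{R}^n}g(x)e^{-I(\underline{y},x)}\,dm(x)$$ whenever the integral exists. A $C^1$ function $g$ with values in $\mathcal{G}_{2n}$ is right-monogenic in a domain $M\subseteq\mathbb{R}^{2n}$ if $g\partial=\sum_{i=1}^n\left(\frac{\partial g}{\partial y_i}e_i+\frac{\partial g}{\partial y'_i}e'_i\right)=0$ on $M$. *)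

(* Defs.v *)
From HB Require Import structures.
From mathcomp Require Import all_boot all_order all_algebra.
From mathcomp Require Import all_classical all_reals all_analysis.

Set Implicit Arguments.
Unset Strict Implicit.
Unset Printing Implicit Defensive.

Import Order.TTheory GRing.Theory Num.Theory.
Import numFieldNormedType.Exports.

Local Open Scope ring_scope.

Section BladeIndices.
Context {m : nat}.
Implicit Types A B C : {set 'I_m}.

Definition symdiff A B : {set 'I_m} := ((A :\: B) :|: (B :\: A))%SET.

(** Number of transpositions needed to sort the word [e_A e_B], where [e_A] is
    the product of the generators indexed by [A] in increasing order. *)
Definition inversions A B : nat :=
  #|[pred p : 'I_m * 'I_m | [&& p.1 \in A, p.2 \in B & (p.2 < p.1)%N]]|.

Lemma in_symdiff A B i : (i \in symdiff A B) = (i \in A) (+) (i \in B).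
Proof. by rewrite !inE; case: (i \in A); case: (i \in B). Qed.

Lemma symdiffA : associative symdiff.
Proof. by move=> A B C; apply/setP => i; rewrite !in_symdiff addbA. Qed.

Lemma symdiff0s : left_id finset.set0 symdiff.
Proof. by move=> A; apply/setP => i; rewrite in_symdiff !inE. Qed.

Lemma symdiffs0 : right_id finset.set0 symdiff.
Proof. by move=> A; apply/setP => i; rewrite in_symdiff !inE addbF. Qed.

Lemma odd_inversions A B : odd (inversions A B) =
  \big[addb/false]_p [&& p.1 \in A, p.2 \in B & (p.2 < p.1)%N].
Proof.
rewrite /inversions -sum1_card big_mkcond (big_morph _ oddD (erefl _)).
by apply: eq_bigr => p _; rewrite !inE; case: ifP.
Qed.

Lemma odd_inversions_symdiffl A B C : odd (inversions (symdiff A B) C) =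
  odd (inversions A C) (+) odd (inversions B C).
Proof.
rewrite !odd_inversions -big_split; apply: eq_bigr => p _.
rewrite in_symdiff.
by case: (_ \in A); case: (_ \in B); case: (_ \in C); case: (_ < _)%N.
Qed.

Lemma odd_inversions_symdiffr A B C : odd (inversions A (symdiff B C)) =
  odd (inversions A B) (+) odd (inversions A C).
Proof.
rewrite !odd_inversions -big_split; apply: eq_bigr => p _.
rewrite in_symdiff.
by case: (_ \in A); case: (_ \in B); case: (_ \in C); case: (_ < _)%N.
Qed.

Lemma inversions0s A : inversions finset.set0 A = 0%N.
Proof. by apply: eq_card0 => p; rewrite !inE. Qed.

Lemma inversionss0 A : inversions A finset.set0 = 0%N.
Proof. by apply: eq_card0 => p; rewrite !inE andbF. Qed.

End BladeIndices.

(** Elements are families of coordinates [alpha_I] in the basis of ordered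
    products [e_I], for [I] a subset of ['I_m]. *)
Definition clifford (R : realType) (m : nat) := {ffun {set 'I_m} -> R^o}.

HB.instance Definition _ (R : realType) m := GRing.Lmodule.on (clifford R m).

Section CliffordAlgebra.
Context {R : realType} {m : nat}.
Local Notation G := (clifford R m).
Implicit Types (x y z : G) (A B C : {set 'I_m}).

Definition clblade A : G := [ffun B => (B == A)%:R].

Definition clgen (i : 'I_m) : G := clblade [set i]%SET.

(** Bilinear extension of [e_A e_B = (-1)^(inversions A B) e_(symdiff A B)];
    the generators common to [A] and [B] cancel since [e_i ^ 2 = 1]. *)
Definition clmul x y : G :=
  \sum_A \sum_B (x A * y B * (-1) ^+ inversions A B) *: clblade (symdiff A B).

Definition clnorm x : R := Num.sqrt (\sum_A x A ^+ 2).

Lemma clE x : x = \sum_A x A *: clblade A.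
Proof.
apply/ffunP => B; rewrite sum_ffunE (bigD1 B)//= big1 ?addr0.
  by rewrite !ffunE eqxx [_ *: _]mulr1.
by move=> A AB; rewrite !ffunE eq_sym (negPf AB) scaler0.
Qed.

Lemma clmulDl : left_distributive clmul +%R.
Proof.
move=> x y z; rewrite /clmul -big_split/=; apply: eq_bigr => A _.
rewrite -big_split/=; apply: eq_bigr => B _.
by rewrite ffunE -scalerDl !mulrDl.
Qed.

Lemma clmulDr : right_distributive clmul +%R.
Proof.
move=> x y z; rewrite /clmul -big_split/=; apply: eq_bigr => A _.
rewrite -big_split/=; apply: eq_bigr => B _.
by rewrite ffunE -scalerDl mulrDr !mulrDl.
Qed.

Lemma clscaleAl (k : R) x y : k *: clmul x y = clmul (k *: x) y.
Proof.
rewrite /clmul scaler_sumr; apply: eq_bigr => A _.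
rewrite scaler_sumr; apply: eq_bigr => B _.
by rewrite ffunE scalerA !mulrA.
Qed.

Lemma clscaleAr (k : R) x y : k *: clmul x y = clmul x (k *: y).
Proof.
rewrite /clmul scaler_sumr; apply: eq_bigr => A _.
rewrite scaler_sumr; apply: eq_bigr => B _.
by rewrite ffunE scalerA !mulrA [x A * _]mulrC.
Qed.

Lemma clmul0l x : clmul 0 x = 0.
Proof. by rewrite -[0 in LHS](scale0r (0 : G)) -clscaleAl scale0r. Qed.

Lemma clmul0r x : clmul x 0 = 0.
Proof. by rewrite -[0 in LHS](scale0r (0 : G)) -clscaleAr scale0r. Qed.

Lemma clmul_suml (F : {set 'I_m} -> G) y :
  clmul (\sum_A F A) y = \sum_A clmul (F A) y.
Proof. exact: (big_morph (clmul^~ y) (fun a b => clmulDl a b y) (clmul0l y)).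
Qed.

Lemma clmul_sumr x (F : {set 'I_m} -> G) :
  clmul x (\sum_A F A) = \sum_A clmul x (F A).
Proof. exact: (big_morph (clmul x) (clmulDr x) (clmul0r x)). Qed.

Lemma clblade_mul A B : clmul (clblade A) (clblade B) =
  (-1) ^+ inversions A B *: clblade (symdiff A B).
Proof.
rewrite /clmul (bigD1 A)//= [X in _ + X]big1 ?addr0; last first.
  move=> C CA; rewrite big1// => D _.
  by rewrite ffunE (negPf CA) !mul0r scale0r.
rewrite (bigD1 B)//= big1 ?addr0; last first.
  by move=> D DB; rewrite [clblade B D]ffunE (negPf DB) mulr0 mul0r scale0r.
by rewrite !ffunE !eqxx !mul1r.
Qed.

Lemma clblade_mulA A B C :
  clmul (clblade A) (clmul (clblade B) (clblade C)) =
  clmul (clmul (clblade A) (clblade B)) (clblade C).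
Proof.
rewrite !clblade_mul -clscaleAl -clscaleAr !clblade_mul !scalerA symdiffA.
congr (_ *: _); rewrite -!exprD -signr_odd -[RHS]signr_odd !oddD.
rewrite odd_inversions_symdiffl odd_inversions_symdiffr.
by rewrite addbC -addbA.
Qed.

Lemma clmulA : associative clmul.
Proof.
move=> x y z; rewrite [x]clE.
rewrite (clmul_suml _ (clmul y z)) (clmul_suml _ y) (clmul_suml _ z).
apply: eq_bigr => A _; rewrite -!clscaleAl; congr (_ *: _).
rewrite [y]clE (clmul_suml _ z) !(clmul_sumr (clblade A)) (clmul_suml _ z).
apply: eq_bigr => B _.
rewrite -!clscaleAl -!clscaleAr -clscaleAl; congr (_ *: _).
rewrite [z]clE (clmul_sumr (clblade B)) (clmul_sumr (clblade A)).
rewrite (clmul_sumr (clmul _ _)); apply: eq_bigr => C _.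
by rewrite -!clscaleAr clblade_mulA.
Qed.

Lemma clmul1l : left_id (clblade finset.set0) clmul.
Proof.
move=> x; rewrite {1}[x]clE clmul_sumr [RHS]clE; apply: eq_bigr => A _.
by rewrite -clscaleAr clblade_mul inversions0s symdiff0s scale1r.
Qed.

Lemma clmul1r : right_id (clblade finset.set0) clmul.
Proof.
move=> x; rewrite {1}[x]clE clmul_suml [RHS]clE; apply: eq_bigr => A _.
by rewrite -clscaleAl clblade_mul inversionss0 symdiffs0 scale1r.
Qed.

Lemma clone_neq0 : clblade finset.set0 != 0.
Proof.
apply/eqP => /ffunP /(_ finset.set0) /eqP.
by rewrite !ffunE eqxx oner_eq0.
Qed.

Lemma clnormZ (k : R) x : clnorm (k *: x) = `|k| * clnorm x.
Proof.
rewrite /clnorm -sqrtr_sqr -sqrtrM ?sqr_ge0// mulr_sumr.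
by congr Num.sqrt; apply: eq_bigr => A _; rewrite ffunE [k *: _]/(k * _) exprMn.
Qed.

Lemma clnorm_eq0 x : clnorm x = 0 -> x = 0.
Proof.
move/eqP; rewrite sqrtr_eq0 => x0; apply/ffunP => A; rewrite ffunE.
have /eqP : \sum_A x A ^+ 2 = 0.
  by apply/eqP; rewrite eq_le x0 sumr_ge0// => B _; rewrite sqr_ge0.
rewrite psumr_eq0 => [/allP /(_ A)|B _]; last exact: sqr_ge0.
by rewrite mem_index_enum sqrf_eq0 => /(_ isT) /eqP.
Qed.

Lemma cl_cauchy_schwarz x y :
  (\sum_A x A * y A) ^+ 2 <= (\sum_A x A ^+ 2) * (\sum_A y A ^+ 2).
Proof.
have : 0 <= \sum_A \sum_B (x A * y B - x B * y A) ^+ 2.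
  by apply: sumr_ge0 => A _; apply: sumr_ge0 => B _; exact: sqr_ge0.
have -> : \sum_A \sum_B (x A * y B - x B * y A) ^+ 2 =
    ((\sum_A x A ^+ 2) * (\sum_A y A ^+ 2)) *+ 2 - (\sum_A x A * y A) ^+ 2 *+ 2.
  set X := \sum_A x A ^+ 2; set Y := \sum_A y A ^+ 2; set Z := \sum_A x A * y A.
  have -> : X * Y *+ 2 - Z ^+ 2 *+ 2 = \sum_A (x A ^+ 2 * Y
      - x A * y A * Z *+ 2 + y A ^+ 2 * X).
    rewrite !big_split/= sumrN sumrMnl -!mulr_suml -/X -/Y -/Z -expr2.
    by rewrite [Y * X]mulrC addrAC mulr2n.
  apply: eq_bigr => A _; rewrite !mulr_sumr -sumrMnl -sumrN -!big_split/=.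
  apply: eq_bigr => B _; rewrite sqrrB !exprMn [x B ^+ 2 * _]mulrC.
  by rewrite [x B * y A]mulrC !mulrA [x A * y B * _]mulrAC
    [x A * y A * y B * _]mulrAC.
by rewrite -mulrnBl pmulrn_lge0// subr_ge0.
Qed.

Lemma clnormD x y : clnorm (x + y) <= clnorm x + clnorm y.
Proof.
have ge0 z : 0 <= \sum_A z A ^+ 2 by apply: sumr_ge0 => A _; exact: sqr_ge0.
rewrite -ler_sqr ?nnegrE ?addr_ge0 ?sqrtr_ge0// sqrrD !sqr_sqrtr//.
have -> : \sum_A (x + y) A ^+ 2 =
    \sum_A x A ^+ 2 + (\sum_A x A * y A) *+ 2 + \sum_A y A ^+ 2.
  rewrite -sumrMnl -!big_split/=; apply: eq_bigr => A _.
  by rewrite ffunE sqrrD.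
rewrite lerD2r lerD2l lerMn2r/= /clnorm -sqrtrM//.
apply: le_trans (ler_norm _) _; rewrite -sqrtr_sqr ler_wsqrtr//.
exact: cl_cauchy_schwarz.
Qed.

End CliffordAlgebra.

HB.instance Definition _ (R : realType) m :=
  GRing.Zmodule_isNzRing.Build (clifford R m)
    clmulA clmul1l clmul1r clmulDl clmulDr clone_neq0.

HB.instance Definition _ (R : realType) m :=
  GRing.Lmodule_isLalgebra.Build R (clifford R m) clscaleAl.

HB.instance Definition _ (R : realType) m :=
  GRing.Lalgebra_isAlgebra.Build R (clifford R m) clscaleAr.

HB.instance Definition _ (R : realType) m :=
  Lmodule_isNormed.Build R (clifford R m) clnormD clnormZ clnorm_eq0.

Lemma clgen_sqr (R : realType) m (i : 'I_m) : clgen i * clgen i = 1 :> clifford R m.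
Proof.
rewrite /clgen [LHS]clblade_mul (_ : inversions _ _ = 0%N) ?scale1r.
  by congr clblade; apply/setP => j; rewrite in_symdiff addbb inE.
apply: eq_card0 => p; rewrite !inE; apply/negP => /and3P[/eqP-> /eqP->].
by rewrite ltnn.
Qed.

Lemma clgen_anticomm (R : realType) m (i j : 'I_m) : i != j ->
  clgen i * clgen j = - (clgen j * clgen i) :> clifford R m.
Proof.
have inv1 (k l : 'I_m) : inversions [set k]%SET [set l]%SET = (l < k)%N.
  rewrite /inversions; case: ltnP => lk.
    rewrite /= -(card1 (k, l)); apply: eq_card => -[a b]; rewrite !inE xpair_eqE.
    by case: eqP => //= ->; case: eqP => //= ->.
  apply: eq_card0 => -[a b]; rewrite !inE /=.
  by case: eqP => //= ->; case: eqP => //= ->; rewrite ltnNge lk.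
have mulE (k l : 'I_m) : clgen k * clgen l =
    (-1) ^+ (l < k)%N *: clblade (symdiff [set k]%SET [set l]%SET) :> clifford R m.
  by rewrite -inv1; exact: clblade_mul.
move=> ij; rewrite !mulE -scaleNr; congr (_ *: clblade _).
  by move: ij; rewrite -val_eqE; case: ltngtP => //= _ _; rewrite ?opprK.
by apply/setP => k; rewrite !in_symdiff addbC.
Qed.

Local Open Scope classical_set_scope.

(** Product sigma-algebra: the one generated by the coordinates. *)
Section MeasurableRow.
Context {d : measure_display} {T : measurableType d} {n : nat}.

Let coords : 'I_n -> 'rV[T]_n -> T := fun i v => v ord0 i.

Let rV_set0 : g_sigma_preimage coords set0.
Proof. exact: sigma_algebra0. Qed.

Let rV_setC A : g_sigma_preimage coords A -> g_sigma_preimage coords (~` A).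
Proof. exact: sigma_algebraC. Qed.

Let rV_bigcup (F : _^nat) : (forall i, g_sigma_preimage coords (F i)) ->
  g_sigma_preimage coords (\bigcup_i (F i)).
Proof. exact: sigma_algebra_bigcup. Qed.

HB.instance Definition _ := @isMeasurable.Build (measure_tuple_display d)
  'rV[T]_n (g_sigma_preimage coords) rV_set0 rV_setC rV_bigcup.

Lemma measurable_coord (i : 'I_n) :
  measurable_fun [set: 'rV[T]_n] (fun v : 'rV[T]_n => v ord0 i).
Proof.
move=> _ Y mY; rewrite setTI; apply: sub_sigma_algebra => /=.
rewrite -bigcup_seq/=; exists i => /=; first by rewrite mem_index_enum.
by exists Y => //; rewrite setTI.
Qed.

Lemma measurable_fun_rV d' (S : measurableType d') (f : S -> 'rV[T]_n) :
  (forall i, measurable_fun [set: S] (fun x => f x ord0 i)) ->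
  measurable_fun [set: S] f.
Proof.
move=> mf; apply: measurability => //=.
move=> _ [A + <-]; rewrite -bigcup_seq/= => -[i _ [B mB <-]].
by rewrite !setTI -comp_preimage -[X in measurable X]setTI; exact: mf.
Qed.

End MeasurableRow.

Section LebesgueRow.
Context {R : realType}.

Definition rVcons n (p : measurableTypeR R * 'rV[R]_n) : 'rV[R]_n.+1 :=
  row_mx p.1%:M p.2 : 'rV[R]_(1 + n).

Definition rVuncons n (v : 'rV[R]_n.+1) : measurableTypeR R * 'rV[R]_n :=
  (v ord0 ord0, rsubmx (v : 'rV[R]_(1 + n))).

Lemma rVcons0 n (p : measurableTypeR R * 'rV[R]_n) : rVcons p ord0 ord0 = p.1.
Proof.
rewrite /rVcons (_ : (ord0 : 'I_n.+1) = lshift n (ord0 : 'I_1)).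
  by rewrite [LHS](row_mxEl (_ : 'M[R]_1)) mxE eqxx.
exact: val_inj.
Qed.

Lemma rVconsS n (p : measurableTypeR R * 'rV[R]_n) i : rVcons p ord0 (lift ord0 i) = p.2 ord0 i.
Proof.
rewrite /rVcons (_ : lift ord0 i = rshift 1 i); last exact: val_inj.
exact: (row_mxEr (_ : 'M[R]_1)).
Qed.

Lemma rVconsK n : cancel (@rVcons n) (@rVuncons n).
Proof.
by case=> x v; rewrite /rVuncons rVcons0 /rVcons row_mxKr.
Qed.

Lemma rVunconsK n : cancel (@rVuncons n) (@rVcons n).
Proof.
move=> v; apply/rowP => i; case: (unliftP ord0 i) => [j ->|->].
  by rewrite rVconsS mxE; congr (v _ _); exact: val_inj.
by rewrite rVcons0.
Qed.

Lemma measurable_rVcons n :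
  measurable_fun [set: measurableTypeR R * 'rV[R]_n] (@rVcons n).
Proof.
apply: measurable_fun_rV => i; case: (unliftP ord0 i) => [j ->|->].
  under eq_fun do rewrite rVconsS.
  exact: (measurableT_comp (measurable_coord j) measurable_snd).
under eq_fun do rewrite rVcons0.
exact: (@measurable_fst _ _ (measurableTypeR R) 'rV[R]_n).
Qed.

Lemma measurable_rVuncons n :
  measurable_fun [set: 'rV[R]_n.+1] (@rVuncons n).
Proof.
apply: measurable_fun_pair; first exact: measurable_coord.
apply: measurable_fun_rV => i.
under eq_fun do rewrite mxE.
exact: measurable_coord.
Qed.

HB.instance Definition _ n :=
  isMeasurableFun.Build _ _ _ _ (@rVcons n) (@measurable_rVcons n).

Section Step.
Context {n : nat} (mu : {sigma_finite_measure set 'rV[R]_n -> \bar R}).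

Definition lebesgue_rV_step : set 'rV[R]_n.+1 -> \bar R :=
  pushforward (lebesgue_measure \x mu)%E (@rVcons n).

Let step0 : lebesgue_rV_step set0 = 0%E.
Proof. by rewrite /lebesgue_rV_step /pushforward preimage_set0 measure0. Qed.

Let step_ge0 A : (0 <= lebesgue_rV_step A)%E.
Proof. exact: (measure_ge0 (lebesgue_measure \x mu)%E). Qed.

Let step_sigma_additive : semi_sigma_additive lebesgue_rV_step.
Proof.
pose pm : {measure set 'rV[R]_n.+1 -> \bar R} :=
  measure_function_pushforward__canonical__measure_function_Measure
    (lebesgue_measure \x mu)%E (@measurable_rVcons n).
exact: (@measure_semi_sigma_additive _ _ _ pm).
Qed.

HB.instance Definition _ := isMeasure.Build _ _ _ lebesgue_rV_step
  step0 step_ge0 step_sigma_additive.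

Let step_sigma_finite : sigma_finite setT lebesgue_rV_step.
Proof.
have /sigma_finiteP[F [TF ndF Foo]] := sigma_finiteT (@lebesgue_measure R).
have /sigma_finiteP[G [TG ndG Goo]] := sigma_finiteT mu.
exists (fun k => @rVuncons n @^-1` (F k `*` G k)).
  rewrite -preimage_bigcup (_ : \bigcup_i _ = setT) ?preimage_setT//.
  apply/seteqP; split => // -[x v] _.
  have [k _ Fx] : (\bigcup_i F i) x by rewrite -TF.
  have [l _ Gv] : (\bigcup_i G i) v by rewrite -TG.
  exists (maxn k l) => //; split.
  - by move: x Fx; exact/subsetPset/ndF/leq_maxl.
  - by move: v Gv; exact/subsetPset/ndG/leq_maxr.
move=> k; have [mF Fk] := Foo k; have [mG Gk] := Goo k.
have mFG : measurable (F k `*` G k) by exact: measurableX.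
split; first by rewrite -[X in measurable X]setTI; exact: measurable_rVuncons.
rewrite /lebesgue_rV_step /pushforward -comp_preimage.
rewrite (_ : _ \o _ = id); last exact/funext/rVconsK.
by rewrite preimage_id product_measure1E// lte_mul_pinfty// ge0_fin_numE.
Qed.

HB.instance Definition _ := Measure_isSigmaFinite.Build _ _ _
  lebesgue_rV_step step_sigma_finite.

End Step.

Fixpoint lebesgue_rV n : {sigma_finite_measure set 'rV[R]_n -> \bar R} :=
  match n with
  | 0 => \d_(0 : 'rV[R]_0)
  | n'.+1 => lebesgue_rV_step (lebesgue_rV n')
  end.

Lemma lebesgue_rV_box n (A : 'I_n -> set R) : (forall i, measurable (A i)) ->
  lebesgue_rV n [set v | forall i, A i (v ord0 i)] =
  (\prod_(i < n) lebesgue_measure (A i))%E.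
Proof.
elim: n A => [|n IH] A mA /=.
  by rewrite big_ord0 diracE mem_set// => -[].
rewrite big_ord_recl -IH//= /lebesgue_rV_step /pushforward.
have mbox : measurable [set v : 'rV[R]_n | forall i, A (lift ord0 i) (v ord0 i)].
  rewrite [X in measurable X](_ : _ =
      \bigcap_(i in [set: 'I_n]) (fun v : 'rV[R]_n => v ord0 i) @^-1`
        A (lift ord0 i)); last first.
    by apply/seteqP; split => [v vA i _|v vA i]; [exact: vA | exact: (vA i)].
  apply: fin_bigcap_measurable => // i _.
  by rewrite -[X in measurable X]setTI; exact: measurable_coord.
rewrite -product_measure1E//; last exact: (mA ord0).
congr (_ _); apply/seteqP; split => -[x v] /=.
  move=> vA; split=> [|i]; first by have := vA ord0; rewrite rVcons0.
  by have := vA (lift ord0 i); rewrite rVconsS.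
move=> [Ax vA] i; case: (unliftP ord0 i) => [j ->|->].
  by rewrite rVconsS; exact: vA.
by rewrite rVcons0.
Qed.

End LebesgueRow.

Section CliffordAnalysis.
Context {R : realType}.

(** Exponential series in the Clifford algebra, for the norm topology. *)
Definition clexp m (a : clifford R m) : clifford R m :=
  limn (series (fun k => (k`!%:R : R)^-1 *: a ^+ k)).

Context {n : nat}.

Definition dm : {measure set 'rV[R]_n -> \bar R} :=
  mscale (NngNum (powR_ge0 (2 * pi) (- (n%:R / 2)))) (lebesgue_rV n).

(** Integrability and integral of functions with values in a finite-dimensional
    space are taken coordinatewise. *)
Definition clintegrable m (g : 'rV[R]_n -> clifford R m) : Prop :=
  forall A, dm.-integrable setT (fun x => (g x A)%:E).

Definition clint m (g : 'rV[R]_n -> clifford R m) : clifford R m :=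
  [ffun A => \int[dm]_x g x A].

(** In [R^(2n)], the vectors [e_i] are the first [n] basis vectors and the
    [e'_i] the last [n]; [y = row_mx u v] stands for [u + v'], so that
    [lsubmx] and [rsubmx] extract the two components. *)
Definition el (i : 'I_n) : clifford R (n + n) := clgen (lshift n i).
Definition er (i : 'I_n) : clifford R (n + n) := clgen (rshift n i).
Definition bivec (i : 'I_n) : clifford R (n + n) := el i * er i.

Definition dotrV (x y : 'rV[R]_n) : R := \sum_i x ord0 i * y ord0 i.

Definition Iform (x y : 'rV[R]_n) : clifford R (n + n) :=
  \sum_i (x ord0 i * y ord0 i) *: bivec i.

Definition Iform2 (y : 'rV[R]_(n + n)) (x : 'rV[R]_n) : clifford R (n + n) :=
  Iform x (lsubmx y) + (dotrV x (rsubmx y))%:A.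

Definition inv_clifford_fourier (f : 'rV[R]_n -> clifford R (n + n))
    (x : 'rV[R]_n) : clifford R (n + n) :=
  clint (fun t => f t * clexp (Iform x t)).

Definition F2_integrand (g : 'rV[R]_n -> clifford R (n + n))
    (y : 'rV[R]_(n + n)) (x : 'rV[R]_n) : clifford R (n + n) :=
  g x * clexp (- Iform2 y x).

Definition F2 (g : 'rV[R]_n -> clifford R (n + n)) (y : 'rV[R]_(n + n)) :
  clifford R (n + n) := clint (F2_integrand g y).

(** [C^1] on an open set: the partial derivatives exist and are continuous. *)
Definition C1_on (M : set 'rV[R]_(n + n))
    (g : 'rV[R]_(n + n) -> clifford R (n + n)) : Prop :=
  forall k, (forall y, M y -> derivable g y (delta_mx ord0 k)) /\
            (forall y, M y -> {for y, continuous ('D_(delta_mx ord0 k) g)}).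

Definition right_dirac (g : 'rV[R]_(n + n) -> clifford R (n + n))
    (y : 'rV[R]_(n + n)) : clifford R (n + n) :=
  \sum_(i < n) ('D_(delta_mx ord0 (lshift n i)) g y * el i +
                'D_(delta_mx ord0 (rshift n i)) g y * er i).

(** Meaningful for open [M] only, since derivatives are two-sided. *)
Definition right_monogenic (M : set 'rV[R]_(n + n))
    (g : 'rV[R]_(n + n) -> clifford R (n + n)) : Prop :=
  C1_on M g /\ forall y, M y -> right_dirac g y = 0.

End CliffordAnalysis.

Lemma clifford_normE (R : realType) m (x : clifford R m) :
  `|x| = Num.sqrt (\sum_A x A ^+ 2).
Proof. by []. Qed.

(* Main.v *)
Require Import Defs.
From mathcomp Require Import all_boot all_order all_algebra.
From mathcomp Require Import all_classical all_reals all_analysis.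
From mathcomp Require Import measurable_realfun ring lra.
Import Order.TTheory GRing.Theory Num.Theory.
Import numFieldNormedType.Exports.
Local Open Scope classical_set_scope.
Local Open Scope ring_scope.

(** The bivectors [B_i = e_i e'_i] commute and square to [-1], so the
    exponential of [\sum_i c_i B_i + s] is [e^s] times the product of the plane
    rotations [cos c_i + B_i sin c_i], called a rotor below ([clexp_rotor]).
    This rests on the addition formula for commuting elements ([cvg_expsD]),
    whose remainder is dominated by the remainder of the real addition formula.
    Rotors are bounded and their coordinates are trigonometric polynomials
    ([cl1_rotor], [rotorE]), so every analytic question about the
    Clifford-valued integrals becomes one about real functions, coordinate by
    coordinate.

    Write [g] for the inverse transform of [f]. Moving the parameter in the
    direction [e_i] multiplies the kernel by [cos (t x_i) - B_i sin (t x_i)],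
    and in the direction [e'_i] by [exp (- t x_i)]. Differentiation under the
    integral sign therefore gives the partial derivatives [- H_i B_i] and
    [- H_i] with the same [H_i], the transform of [x_i g] ([is_derive_F2_left]
    and [is_derive_F2_right]). Since [B_i e_i = - e'_i], the two contributions
    [- H_i B_i e_i] and [- H_i e'_i] to the Dirac operator cancel. The [H_i]
    are continuous by dominated convergence: near a parameter the weight
    [exp (- (x, y'))] is at most the sum of its values at finitely many other
    parameters ([expR_dotrV_le]).

    On [R^n] the claim is Fourier inversion. Insert the weight
    [\prod_i exp (- e |x_i|)] in the inversion integral. By Fubini's theorem
    the result is, up to a constant, the convolution of [f] with the product of the Poisson
    kernels [2 e / (e^2 + u_i^2)] ([abel_mean_poisson]). Product kernels are
    awkward for pointwise convergence, because [f] need not be bounded;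
    averaging over a box removes the difficulty. The average of a Poisson
    kernel over a segment is a difference of arctangents, which is bounded and
    tends almost everywhere to the indicator function of the segment, so
    dominated convergence applies on both sides and [f] has the same integral
    over every box as the inversion integral ([box_mean_inversion]). Both
    functions are continuous, hence equal ([F2_inversion]). *)

(** * Norms and convergence in the Clifford algebra *)

Section FiniteSums.
Context {R : realType}.

Lemma cvg_fsum (T I : Type) (F : set_system T) {FF : Filter F} (r : seq I)
    (P : pred I) (u : I -> T -> R) (l : I -> R) :
  (forall i, P i -> u i x @[x --> F] --> l i) ->
  \sum_(i <- r | P i) u i x @[x --> F] --> \sum_(i <- r | P i) l i.
Proof.
move=> ul; elim: r => [|i r IH].
  rewrite big_nil; under eq_fun do rewrite big_nil; exact: cvg_cst.
rewrite big_cons; under eq_fun do rewrite big_cons.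
by case: ifPn => // Pi; apply: cvgD => //; exact: ul.
Qed.

Lemma cvg_fprod (T I : Type) (F : set_system T) {FF : Filter F} (r : seq I)
    (u : I -> T -> R) (l : I -> R) :
  (forall i, u i x @[x --> F] --> l i) ->
  \prod_(i <- r) u i x @[x --> F] --> \prod_(i <- r) l i.
Proof.
move=> ul; elim: r => [|i r IH].
  rewrite big_nil; under eq_fun do rewrite big_nil; exact: cvg_cst.
rewrite big_cons; under eq_fun do rewrite big_cons.
by apply: cvgM => //; exact: ul.
Qed.

End FiniteSums.

Section CliffordNorm.
Context {R : realType} {m : nat}.
Local Notation G := (clifford R m).
Implicit Types (x y z : G) (A B C : {set 'I_m}).

Definition cl1 x : R := \sum_A `|x A|.

Lemma clmulE x y C : (x * y) C =
  \sum_A \sum_B (x A * y B * (-1) ^+ inversions A B * (C == symdiff A B)%:R).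
Proof.
rewrite [x * y]/(clmul x y) /clmul sum_ffunE; apply: eq_bigr => A _.
by rewrite sum_ffunE; apply: eq_bigr => B _; rewrite !ffunE.
Qed.

Lemma clcoordD x y A : (x + y) A = x A + y A. Proof. by rewrite ffunE. Qed.
Lemma clcoordN x A : (- x) A = - x A. Proof. by rewrite ffunE. Qed.
Lemma clcoordZ (k : R) x A : (k *: x) A = k * x A.
Proof. by rewrite ffunE. Qed.

Lemma cl1_ge0 x : 0 <= cl1 x. Proof. exact: sumr_ge0. Qed.

Lemma cl1_coord x A : `|x A| <= cl1 x.
Proof. by rewrite /cl1 (bigD1 A)//= lerDl sumr_ge0. Qed.

Lemma cl1D x y : cl1 (x + y) <= cl1 x + cl1 y.
Proof.
by rewrite /cl1 -big_split/=; apply: ler_sum => A _; rewrite clcoordD ler_normD.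
Qed.

Lemma cl1Z (k : R) x : cl1 (k *: x) = `|k| * cl1 x.
Proof.
by rewrite /cl1 mulr_sumr; apply: eq_bigr => A _; rewrite clcoordZ normrM.
Qed.

Lemma cl1_sum (I : Type) (r : seq I) (P : pred I) (F : I -> G) :
  cl1 (\sum_(i <- r | P i) F i) <= \sum_(i <- r | P i) cl1 (F i).
Proof.
elim/big_rec2: _ => [|i u v _ le_uv].
  by rewrite /cl1 big1// => A _; rewrite ffunE normr0.
by rewrite (le_trans (cl1D _ _))// lerD2l.
Qed.

Lemma cl1_blade A : cl1 (clblade A : G) = 1.
Proof.
rewrite /cl1 (bigD1 A)//= big1 ?addr0; first by rewrite ffunE eqxx normr1.
by move=> B BA; rewrite ffunE (negPf BA) normr0.
Qed.

Lemma cl1_1 : cl1 (1 : G) = 1.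
Proof. exact: cl1_blade. Qed.

Lemma cl1_gen (i : 'I_m) : cl1 (clgen i : G) = 1.
Proof. exact: cl1_blade. Qed.

(** The product of two blades is a blade up to sign, so the sum of the absolute
    values of the coordinates, unlike the Euclidean norm, is submultiplicative
    with constant one. *)
Lemma cl1M x y : cl1 (x * y) <= cl1 x * cl1 y.
Proof.
rewrite [x * y]/(clmul x y) /clmul (le_trans (cl1_sum _ _ _ _))//.
rewrite /cl1 mulr_suml.
apply: ler_sum => A _; rewrite -/(cl1 _) (le_trans (cl1_sum _ _ _ _))//.
rewrite mulr_sumr; apply: ler_sum => B _.
by rewrite cl1Z cl1_blade mulr1 !normrM normrX normrN1 expr1n mulr1.
Qed.

Lemma cl1X x k : cl1 (x ^+ k) <= cl1 x ^+ k.
Proof.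
elim: k => [|k IH]; first by rewrite !expr0 cl1_1.
rewrite !exprS (le_trans (cl1M _ _))//.
by apply: ler_wpM2l => //; exact: cl1_ge0.
Qed.

Lemma cl1_prod (I : Type) (r : seq I) (F : I -> G) :
  cl1 (\prod_(i <- r) F i) <= \prod_(i <- r) cl1 (F i).
Proof.
elim/big_rec2: _ => [|i u v _ le_uv]; first by rewrite cl1_1.
rewrite (le_trans (cl1M _ _))//; apply: ler_wpM2l => //; exact: cl1_ge0.
Qed.

Lemma clnorm_le_cl1 x : `|x| <= cl1 x.
Proof.
rewrite clifford_normE -ler_sqr ?nnegrE ?sqrtr_ge0 ?cl1_ge0//.
rewrite sqr_sqrtr; last by apply: sumr_ge0 => A _; exact: sqr_ge0.
rewrite expr2 {1}/cl1 mulr_suml; apply: ler_sum => A _.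
by rewrite -real_normK ?num_real// expr2 ler_wpM2l// cl1_coord.
Qed.

Lemma coord_le_clnorm x A : `|x A| <= `|x|.
Proof.
rewrite clifford_normE -sqrtr_sqr ler_wsqrtr// (bigD1 A)//= lerDl.
by apply: sumr_ge0 => B _; exact: sqr_ge0.
Qed.

(** All norms being equivalent in finite dimension, convergence may be tested on
    coordinates. *)
Lemma clcvgP (T : Type) (F : set_system T) {FF : Filter F} (u : T -> G)
    (l : G) :
  (u t @[t --> F] --> l) <-> (forall A, u t A @[t --> F] --> l A).
Proof.
split=> [ul A|ul].
  apply/cvgrPdist_le => e e0; move/cvgrPdist_le : ul => /(_ e e0).
  apply: filterS => t; apply: le_trans.
  by rewrite -clcoordN -clcoordD; exact: coord_le_clnorm.
have : cl1 (l - u t) @[t --> F] --> 0.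
  have -> : 0 = \sum_(A : {set 'I_m}) `|l A - l A|.
    by rewrite big1// => A _; rewrite subrr normr0.
  apply: cvg_fsum => A _; apply: cvg_norm.
  under eq_fun do rewrite clcoordD clcoordN.
  by apply: cvgB; [exact: cvg_cst|exact: ul].
move=> /cvgrPdist_le ul0; apply/cvgrPdist_le => e e0.
apply: filterS (ul0 _ e0) => t; rewrite sub0r normrN ger0_norm ?cl1_ge0//.
by apply: le_trans; exact: clnorm_le_cl1.
Qed.

Lemma clcvgM (T : Type) (F : set_system T) {FF : Filter F} (u v : T -> G)
    (k l : G) : u t @[t --> F] --> k -> v t @[t --> F] --> l ->
  u t * v t @[t --> F] --> k * l.
Proof.
move=> /clcvgP uk /clcvgP vl; apply/clcvgP => C.
rewrite clmulE; under eq_fun do rewrite clmulE.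
apply: cvg_fsum => A _; apply: cvg_fsum => B _.
by do 2!(apply: cvgM; last exact: cvg_cst); apply: cvgM.
Qed.

End CliffordNorm.

(** * The exponential of commuting elements *)

Lemma sum_triangle (V : zmodType) (F : nat -> nat -> V) N :
  \sum_(k < N) \sum_(i < k.+1) F (k - i)%N i =
  \sum_(i < N) \sum_(j < N | (i + j < N)%N) F i j.
Proof.
elim: N => [|N IH]; first by rewrite !big_ord0.
rewrite big_ord_recr/= IH.
have split_row (i : nat) : (i <= N)%N ->
    \sum_(j < N.+1 | (i + j < N.+1)%N) F i j =
    \sum_(j < N | (i + j < N)%N) F i j + F i (N - i)%N.
  move=> iN; rewrite !(big_mkcond (fun j : 'I__ => (_ < _)%N)) /=.
  have iN' : (N - i < N.+1)%N by rewrite ltnS leq_subr.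
  rewrite (bigD1 (Ordinal iN'))//= subnKC// ltnSn addrC; congr (_ + _).
  rewrite -(big_mkord xpredT (fun j => if (i + j < N)%N then F i j else 0)).
  rewrite big_mkcond -(big_mkord xpredT (fun j =>
    if j != (N - i)%N then if (i + j < N.+1)%N then F i j else 0 else 0)).
  rewrite big_nat_recr//= [X in _ + X](_ : _ = 0) ?addr0; last first.
    case: eqP => //= NiN; case: ifP => // iNN; case: NiN; move: iNN.
    by case: i {iN iN'} => [|i]; rewrite ?subn0// ltnS addSn ltnNge leq_addl.
  apply: eq_bigr => j _; case: eqP => [->|/eqP jNi]/=.
    by rewrite subnKC// ltnn.
  rewrite ltnS leq_eqVlt; congr (if _ then _ else _).
  suff /negPf-> : (i + j != N)%N by [].
  by apply: contra jNi => /eqP <-; rewrite addKn.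
rewrite [RHS](eq_bigr (fun i : 'I_N.+1 =>
    \sum_(j < N | (i + j < N)%N) F i j + F i (N - i)%N)); last first.
  by move=> i _; apply: split_row; rewrite -ltnS.
rewrite big_split/= [X in _ = X + _]big_ord_recr/=.
rewrite [X in _ = _ + X + _]big_pred0 ?addr0; last first.
  by move=> j; rewrite ltnNge leq_addr.
congr (_ + _); rewrite [LHS](reindex_inj rev_ord_inj)/=.
by apply: eq_bigr => i _; rewrite subSS; congr F; rewrite subKn// -ltnS.
Qed.

Section ExponentialSeries.
Context {R : realType}.

Section Algebra.
Context {V : algType R}.

Definition exps (a : V) : nat -> V :=
  series (fun k => (k`!%:R : R)^-1 *: a ^+ k).

(** Remainder of the Cauchy product: the partial sum of order [N] at [a + b]
    collects exactly the products of total degree less than [N]. *)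
Definition exps_rest (a b : V) N : V :=
  \sum_(i < N) \sum_(j < N | (N <= i + j)%N)
    ((i`!%:R : R)^-1 * (j`!%:R : R)^-1) *: (a ^+ i * b ^+ j).

Lemma expsM (a b : V) N : GRing.comm a b ->
  exps a N * exps b N = exps (a + b) N + exps_rest a b N.
Proof.
move=> ab.
pose F i j := ((i`!%:R : R)^-1 * (j`!%:R : R)^-1) *: (a ^+ i * b ^+ j).
have -> : exps (a + b) N = \sum_(i < N) \sum_(j < N | (i + j < N)%N) F i j.
  rewrite -sum_triangle /exps /series/= big_mkord; apply: eq_bigr => k _.
  rewrite exprDn_comm// scaler_sumr; apply: eq_bigr => i _.
  rewrite /F -[_ *+ 'C(_, _)]scaler_nat scalerA; congr (_ *: _).
  have ik : (i <= k)%N by rewrite -ltnS.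
  rewrite -(bin_fact ik) !natrM !invfM mulrAC mulVf ?mul1r.
    by rewrite mulrC.
  by rewrite pnatr_eq0 -lt0n bin_gt0.
rewrite /exps_rest -big_split/= /exps /series/= !big_mkord mulr_suml.
apply: eq_bigr => i _; rewrite mulr_sumr.
rewrite (bigID (fun j : 'I_N => (i + j < N)%N))/=; congr (_ + _).
  by apply: eq_bigr => j _; rewrite -scalerAl -scalerAr scalerA.
apply: eq_big => [j|j _]; first by rewrite -leqNgt.
by rewrite -scalerAl -scalerAr scalerA.
Qed.

End Algebra.

Lemma cvg_exps_expR (s : R) : exps (s : R^o) n @[n --> \oo] --> (expR s : R^o).
Proof.
have expE : (fun k => (k`!%:R : R)^-1 *: (s : R^o) ^+ k) = exp_coeff s.
  by apply/funext => k; rewrite /exp_coeff/= [LHS]mulrC.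
rewrite /exps expE; exact: is_cvg_series_exp_coeff.
Qed.

Context {m : nat}.
Local Notation G := (clifford R m).

(** The remainder of the Cauchy product is dominated by the remainder for the
    real numbers [cl1 a] and [cl1 b], which tends to zero by the addition
    formula for the real exponential. *)
Lemma cvg_expsD (a b k l : G) : GRing.comm a b ->
  exps a n @[n --> \oo] --> k -> exps b n @[n --> \oo] --> l ->
  exps (a + b) n @[n --> \oo] --> k * l.
Proof.
move=> ab ak bl.
have restE N : exps (a + b) N = exps a N * exps b N - exps_rest a b N.
  by rewrite expsM// addrK.
under eq_fun do rewrite restE.
rewrite -[k * l]subr0; apply: cvgB; first exact: clcvgM.
pose al : R^o := cl1 a; pose be : R^o := cl1 b.
have rest0 : exps_rest al be n @[n --> \oo] --> (0 : R^o).
  have -> : exps_rest al be =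
      (fun n => exps al n * exps be n - exps (al + be) n).
    apply/funext => n; rewrite expsM; last exact: mulrC.
    by rewrite [RHS]addrAC subrr add0r.
  rewrite -(subrr (expR (al + be) : R^o)) {1}expRD.
  by apply: cvgB; [apply: cvgM|]; exact: cvg_exps_expR.
apply: norm_cvg0.
apply: (@squeeze_cvgr _ _ _ _ (fun=> 0) (exps_rest al be) _ _ 0 _ rest0);
  last exact: cvg_cst.
apply: nearW => N; rewrite normr_ge0/= (le_trans (clnorm_le_cl1 _))//.
rewrite (le_trans (cl1_sum _ _ _ _))//; apply: ler_sum => i _.
rewrite (le_trans (cl1_sum _ _ _ _))//; apply: ler_sum => j _.
rewrite cl1Z ger0_norm; last by rewrite mulr_ge0// invr_ge0.
apply: ler_wpM2l; first by rewrite mulr_ge0// invr_ge0.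
rewrite (le_trans (cl1M _ _))// ler_pM ?cl1_ge0 ?cl1X//.
Qed.

Lemma cvg_exps_scalar (s : R) :
  exps (s%:A : G) n @[n --> \oo] --> ((expR s)%:A : G).
Proof.
apply/clcvgP => A.
have E n : exps (s%:A : G) n A = exps (s : R^o) n * (1 : G) A.
  rewrite /exps /series/= sum_ffunE mulr_suml; apply: eq_bigr => k _.
  by rewrite exprZn expr1n !clcoordZ mulrA.
under eq_fun do rewrite E.
by rewrite clcoordZ; apply: cvgM; [exact: cvg_exps_expR|exact: cvg_cst].
Qed.

(** Splitting the series by parity, [B * B = -1] turns the even terms into the
    cosine series and the odd ones into [B] times the sine series. *)
Lemma cvg_exps_rotation (B : G) (c : R) : B * B = -1 ->
  exps (c *: B) n @[n --> \oo] --> (cos c)%:A + sin c *: B.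
Proof.
move=> BB.
have BX k : B ^+ k = ((~~ odd k)%:R * (-1) ^ k./2)%:A +
                     ((odd k)%:R * (-1) ^+ k.-1./2) *: B.
  rewrite -{1}(odd_double_half k) exprD -mul2n exprM expr2 BB.
  have -> : (-1 : G) ^+ k./2 = ((-1) ^+ k./2 : R)%:A.
    by rewrite -[(-1 : G)]scaleN1r exprZn expr1n.
  case: k => [|k]; first by rewrite !mul1r mul0r scale0r addr0.
  rewrite /= uphalf_half; case: (odd k) => /=.
    by rewrite mul1r mul0r scale0r addr0 mul1r -exprnP.
  by rewrite !(mul0r, mul1r, scale0r) add0r expr1 -scalerAr mulr1.
have coordE n A : exps (c *: B) n A =
    series (cos_coeff c) n * (1 : G) A + series (sin_coeff c) n * B A.
  rewrite /exps /series/= sum_ffunE !mulr_suml -big_split/=.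
  apply: eq_bigr => k _; rewrite exprZn !clcoordZ BX clcoordD !clcoordZ.
  have mulE (p q r t v : R) : p * (q * (r * t * v)) = r * t * q * p * v by ring.
  by rewrite mulrDr mulrDr; congr (_ + _); exact: mulE.
apply/clcvgP => A; under eq_fun do rewrite coordE.
rewrite clcoordD !clcoordZ; apply: cvgD; apply: cvgM; try exact: cvg_cst.
  by rewrite unlock; exact: is_cvg_series_cos_coeff.
by rewrite unlock; exact: is_cvg_series_sin_coeff.
Qed.

End ExponentialSeries.

(** * Rotors and the Fourier kernels *)

Section Rotors.
Context {R : realType} {n : nat}.
Local Notation G := (clifford R (n + n)).
Implicit Types (c d : 'I_n -> R).

Lemma lshift_neq_rshift (i j : 'I_n) : lshift n i != rshift n j.
Proof. by rewrite -val_eqE/= neq_ltn ltn_addr. Qed.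

Lemma el_er (i j : 'I_n) : el i * er j = - (er j * el i) :> G.
Proof. exact/clgen_anticomm/lshift_neq_rshift. Qed.

Lemma bivec_sqr (i : 'I_n) : bivec i * bivec i = -1 :> G.
Proof.
rewrite /bivec mulrA -[el i * er i * el i]mulrA -[er i * el i]opprK -el_er.
by rewrite mulrN mulrA !mulNr clgen_sqr mul1r clgen_sqr.
Qed.

Lemma bivec_el (i : 'I_n) : bivec i * el i = - er i :> G.
Proof.
by rewrite /bivec -mulrA -[er i * el i]opprK -el_er mulrN mulrA clgen_sqr mul1r.
Qed.

Lemma bivec_comm (i j : 'I_n) : GRing.comm (bivec i) (bivec j : G).
Proof.
rewrite /GRing.comm; have [->//|ij] := eqVneq i j.
have elel : el i * el j = - (el j * el i) :> G.
  by apply: clgen_anticomm; rewrite -val_eqE.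
have erer : er i * er j = - (er j * er i) :> G.
  by apply: clgen_anticomm; rewrite -val_eqE/= eqn_add2l.
have erel (k l : 'I_n) : er k * el l = - (el l * er k) :> G.
  by rewrite el_er opprK.
have anticomm2 (u v w : G) : u * v = - (v * u) -> u * w = - (w * u) ->
    GRing.comm u (v * w).
  move=> uv uw; rewrite /GRing.comm mulrA uv -[v * w * u]mulrA.
  by rewrite -[w * u]opprK -uw mulNr mulrN mulrA.
rewrite /bivec; apply: commr_sym; apply: commrM; apply: commr_sym.
  exact: anticomm2 (el_er _ _).
exact: anticomm2 (erel _ _) erer.
Qed.

(** The value of the exponential at the element [\sum_i c i *: bivec i]. *)
Definition rotor c : G := \prod_i ((cos (c i))%:A + sin (c i) *: bivec i).

Lemma cvg_exps_rotor c :
  exps (\sum_i c i *: bivec i : G) k @[k --> \oo] --> rotor c.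
Proof.
rewrite /rotor; elim: (index_enum _) => [|i r IH].
  have := @cvg_exps_scalar R (n + n) 0.
  by rewrite !big_nil expR0 scale0r scale1r.
rewrite !big_cons; apply: cvg_expsD => //.
  apply: commr_sum => j _; rewrite /GRing.comm -!(scalerAl, scalerAr).
  by rewrite bivec_comm scalerA mulrC -scalerA.
exact/cvg_exps_rotation/bivec_sqr.
Qed.

Lemma clexp_rotor c (s : R) :
  clexp (\sum_i c i *: bivec i + s%:A : G) = expR s *: rotor c.
Proof.
apply: cvg_lim => //.
have -> : expR s *: rotor c = rotor c * (expR s)%:A.
  by rewrite -scalerAr mulr1.
apply: cvg_expsD; [|exact: cvg_exps_rotor|exact: cvg_exps_scalar].
by rewrite /GRing.comm -scalerAr mulr1 -scalerAl mul1r.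
Qed.

Lemma rotorD c d : rotor (fun i => c i + d i) = rotor c * rotor d.
Proof.
have /cvg_unique := cvg_exps_rotor (fun i => c i + d i); apply => //.
have -> : \sum_i (c i + d i) *: bivec i =
    \sum_i c i *: bivec i + \sum_i d i *: bivec i :> G.
  by rewrite -big_split/=; apply: eq_bigr => i _; rewrite scalerDl.
apply: cvg_expsD; [|exact: cvg_exps_rotor..].
apply: commr_sum => j _; apply: commr_sym; apply: commr_sum => i _.
rewrite /GRing.comm -!(scalerAl, scalerAr).
by rewrite bivec_comm scalerA mulrC -scalerA.
Qed.

Lemma rotor_shift c (i : 'I_n) (t : R) :
  rotor (fun j => c j + (if j == i then t else 0)) =
  rotor c * ((cos t)%:A + sin t *: bivec i).
Proof.
rewrite rotorD; congr (_ * _).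
have /cvg_unique := cvg_exps_rotor (fun j => if j == i then t else 0).
apply => //; rewrite (bigD1 i)//= eqxx big1 ?addr0; last first.
  by move=> j /negPf->; rewrite scale0r.
exact/cvg_exps_rotation/bivec_sqr.
Qed.

Lemma cl1_rotor c : cl1 (rotor c) <= 2 ^+ n.
Proof.
rewrite (le_trans (cl1_prod _ _ _))//.
rewrite (_ : 2 ^+ n = \prod_(i < n) (2 : R)); last first.
  by rewrite prodr_const card_ord.
apply: ler_prod => i _; rewrite cl1_ge0/= (le_trans (cl1D _ _))//.
have cl1_bivec : cl1 (bivec i : G) <= 1.
  by rewrite (le_trans (cl1M _ _))// !cl1_gen mulr1.
have normcos : `|cos (c i)| <= 1 by rewrite ler_norml cos_geN1 cos_le1.
have normsin : `|sin (c i)| <= 1 by rewrite ler_norml sin_geN1 sin_le1.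
rewrite (_ : 2 = 1 + 1)// !cl1Z cl1_1 mulr1 lerD//.
by rewrite -[1]mulr1 ler_pM// cl1_ge0.
Qed.

(** The monomial in the [bivec i] for the [i] such that [s i]; subsets are
    encoded by boolean functions to match the expansion of a product of binary
    sums. *)
Definition bivecs (s : {ffun 'I_n -> bool}) : G :=
  \prod_i (if s i then bivec i else 1).

Definition trig (b : bool) (x : R) : R := if b then sin x else cos x.

(** Separation of variables: the dependence on [c] is a sum of products of
    functions of one coordinate each. *)
Lemma rotorE c : rotor c =
  \sum_(s : {ffun 'I_n -> bool}) (\prod_i trig (s i) (c i)) *: bivecs s.
Proof.
have -> : rotor c = \prod_i \sum_(b : bool)
    trig b (c i) *: (if b then bivec i else 1).
  by apply: eq_bigr => i _; rewrite big_bool/= addrC.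
by rewrite bigA_distr_bigA; apply: eq_bigr => s _; rewrite scaler_prod.
Qed.

Lemma clexp_Iform (x t : 'rV[R]_n) :
  clexp (Iform x t) = rotor (fun i => x ord0 i * t ord0 i).
Proof.
by rewrite -[Iform x t]addr0 -(scale0r (1 : G)) clexp_rotor expR0 scale1r.
Qed.

Lemma clexp_NIform2 (y : 'rV[R]_(n + n)) (x : 'rV[R]_n) :
  clexp (- Iform2 y x) = expR (- dotrV x (rsubmx y)) *:
    rotor (fun i => - (x ord0 i * y ord0 (lshift n i))).
Proof.
rewrite -clexp_rotor; congr clexp.
rewrite /Iform2 opprD -scaleNr; congr (_ + _); rewrite /Iform -sumrN.
by apply: eq_bigr => i _; rewrite mxE scaleNr.
Qed.

End Rotors.

(** * Real-valued integrals *)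

Section RealIntegrals.
Context {R : realType} {d : measure_display} {T : measurableType d}.
Variable mu : {measure set T -> \bar R}.
Implicit Types (u v k : T -> R).

Definition intg u := mu.-integrable setT (EFin \o u).

Lemma intg_measurable u : intg u -> measurable_fun setT u.
Proof. by move=> /measurable_int /measurable_EFinP. Qed.

Lemma intg_eq u v : u =1 v -> intg u -> intg v.
Proof. by move=> /funext ->. Qed.

Lemma intg_le u v : measurable_fun setT u -> intg v ->
  (forall x, `|u x| <= v x) -> intg u.
Proof.
move=> mu_ iv uv; apply: (le_integrable _ _ _ iv) => //.
  exact/measurable_EFinP.
by move=> x _ /=; rewrite lee_fin (le_trans (uv x))// ler_norm.
Qed.

Lemma intgD u v : intg u -> intg v -> intg (fun x => u x + v x).
Proof. by move=> iu iv; exact: (integrableD _ iu iv). Qed.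

Lemma intgB u v : intg u -> intg v -> intg (fun x => u x - v x).
Proof. by move=> iu iv; exact: (integrableB _ iu iv). Qed.

Lemma intgZ (c : R) u : intg u -> intg (fun x => c * u x).
Proof. by move=> iu; exact: (integrableZl _ c iu). Qed.

Lemma intg_norm u : intg u -> intg (fun x => `|u x|).
Proof. exact: integrable_norm. Qed.

Lemma intg_sum (I : Type) (s : seq I) (u : I -> T -> R) :
  (forall i, intg (u i)) -> intg (fun x => \sum_(i <- s) u i x).
Proof.
move=> iu; rewrite /intg
  (_ : EFin \o _ = fun x => (\sum_(i <- s) (u i x)%:E)%E).
  by apply: integrable_sum => // i _; exact: iu.
by apply/funext => x; rewrite /= sumEFin.
Qed.

Lemma intgM (C : R) u k : intg u -> measurable_fun setT k ->
  (forall x, `|k x| <= C) -> intg (fun x => u x * k x).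
Proof.
move=> iu mk kC; apply: (@intg_le _ (fun x => C * `|u x|)).
- by apply: measurable_funM => //; exact: intg_measurable.
- exact/intgZ/intg_norm.
- by move=> x; rewrite normrM mulrC ler_wpM2r.
Qed.

Lemma Rintegral_fsum (I : Type) (s : seq I) (u : I -> T -> R) :
  (forall i, intg (u i)) ->
  \int[mu]_x (\sum_(i <- s) u i x) = \sum_(i <- s) \int[mu]_x u i x.
Proof.
move=> iu; elim: s => [|i s IH].
  rewrite big_nil; under eq_Rintegral do rewrite big_nil.
  by rewrite Rintegral_cst// mul0r.
rewrite big_cons -IH -RintegralD//; last 2 first.
- exact: iu.
- exact: intg_sum.
by apply: eq_Rintegral => x _; rewrite big_cons.
Qed.

Lemma Rintegral_dct_ae (u_ : nat -> T -> R) (u v : T -> R) :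
  (forall n, measurable_fun setT (u_ n)) -> measurable_fun setT u -> intg v ->
  (forall n x, `|u_ n x| <= v x) ->
  {ae mu, forall x, u_ n x @[n --> \oo] --> u x} ->
  intg u /\ \int[mu]_x u_ n x @[n --> \oo] --> \int[mu]_x u x.
Proof.
move=> mu_ mu' iv uv u_u.
have [||||iu _ ulim] := @dominated_convergence _ _ _ mu _ measurableT
    (fun n => EFin \o u_ n) (EFin \o u) (EFin \o v) _ _ _ iv.
- by move=> n; exact/measurable_EFinP.
- exact/measurable_EFinP.
- by apply: filterS u_u => x ux _ /=; apply: cvg_EFin; [exact: nearW|exact: ux].
- by apply: aeW => x n _ /=; rewrite lee_fin.
split => //; apply: fine_cvg; rewrite /Rintegral fineK//.
exact: integrable_fin_num.
Qed.

Lemma Rintegral_dct (u_ : nat -> T -> R) (u v : T -> R) :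
  (forall n, measurable_fun setT (u_ n)) -> intg v ->
  (forall n x, `|u_ n x| <= v x) ->
  (forall x, u_ n x @[n --> \oo] --> u x) ->
  intg u /\ \int[mu]_x u_ n x @[n --> \oo] --> \int[mu]_x u x.
Proof.
move=> mu_ iv uv u_u; apply: (Rintegral_dct_ae _ _ v) => //; last exact: aeW.
exact: measurable_fun_cvg (fun x _ => u_u x).
Qed.

End RealIntegrals.

(** Continuity in a parameter may be tested on sequences that stay in the unit
    ball, where dominating functions are available. *)
Lemma cvg_unit_seq {R : realType} (V : normedModType R) (y0 : V) (F : V -> R)
    (l : R) :
  (forall w : nat -> V,
    w k @[k --> \oo] --> y0 -> (forall k, `|w k - y0| <= 1) ->
    F (w k) @[k --> \oo] --> l) ->
  F y @[y --> y0] --> l.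
Proof.
move=> Fw; apply/cvgrPdist_le => e e0; apply: contrapT => nF.
have badk (k : nat) : exists y, `|y - y0| <= k.+1%:R^-1 /\ e < `|l - F y|.
  apply: contrapT => nbad; apply: nF; rewrite nearE/=.
  apply/nbhs_ballP; exists k.+1%:R^-1 => //= y; rewrite -ball_normE/= distrC.
  move=> yk; rewrite leNgt; apply/negP => ly; apply: nbad; exists y.
  by split => //; exact: ltW.
have [w /all_and2[wk lw]] := choice badk.
have wy : w k @[k --> \oo] --> y0.
  apply/cvgrPdist_le => r r0; near=> k; rewrite distrC (le_trans (wk k))//.
  by rewrite ltW//; near: k; exact: (near_infty_natSinv_lt (PosNum r0)).
have w1 k : `|w k - y0| <= 1.
  by rewrite (le_trans (wk k))// invf_le1// ler1n.
have /cvgrPdist_le /(_ _ e0) [k _ /(_ k (leqnn k))] := Fw w wy w1.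
by rewrite leNgt lw.
Unshelve. all: by end_near. Qed.

Lemma measurable_trig {R : realType} (b : bool) :
  measurable_fun [set: R] (trig b : R -> R).
Proof.
case: b; apply: continuous_measurable_fun.
  exact: continuous_sin.
exact: continuous_cos.
Qed.

Lemma trig_le1 {R : realType} (b : bool) (x : R) : `|trig b x| <= 1.
Proof.
by case: b; rewrite ler_norml /= ?sin_geN1 ?sin_le1 ?cos_geN1 ?cos_le1.
Qed.

Section DiffUnderIntegral.
Context {R : realType} {d : measure_display} {T : measurableType d}.
Variable mu : {measure set T -> \bar R}.
Implicit Types (a b w : T -> R).

Lemma in_unit_itv (t : R) : (`]-1, 1[%classic : set R) t -> `|t| <= 1.
Proof. by rewrite /= in_itv/= => /andP[t1 t2]; rewrite ler_norml !ltW. Qed.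

(** Derivative at [0] of the parameter integral that a rotation of the kernel
    produces; the first moments of [a] and [b] provide the dominating function.
    *)
Lemma diffquot_trig a b w : measurable_fun setT w -> intg mu a -> intg mu b ->
  intg mu (fun x => w x * a x) -> intg mu (fun x => w x * b x) ->
  t^-1 *: (\int[mu]_x (a x * cos (t * w x) - b x * sin (t * w x)) -
    \int[mu]_x a x) @[t --> 0^'] --> \int[mu]_x - (w x * b x).
Proof.
move=> mw ia ib iwa iwb.
pose f (t : R) x := a x * cos (t * w x) - b x * sin (t * w x).
have mtw (t : R) : measurable_fun setT (fun x => t * w x).
  exact: measurable_funM.
have itrig (u : T -> R) (t : R) e : intg mu u ->
    intg mu (fun x => u x * trig e (t * w x)).
  move=> iu; apply: (@intgM _ _ _ mu 1) => // [|x]; last exact: trig_le1.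
  exact: measurableT_comp (measurable_trig e) (mtw t).
have df (t : R) x : is_derive t 1 (f ^~ x)
    (- (w x * a x * sin (t * w x)) - w x * b x * cos (t * w x)).
  by rewrite /f; apply: is_derive_eq; rewrite /GRing.scale/=; ring.
have d1f t x : partial1of2 f t x =
    - (w x * a x * sin (t * w x)) - w x * b x * cos (t * w x).
  by rewrite partial1of2E; apply: derive_val.
have f0 : \int[mu]_x a x = \int[mu]_x f 0 x.
  by apply: eq_Rintegral => x _; rewrite /f mul0r sin0 cos0 mulr0 subr0 mulr1.
have d1f0 : \int[mu]_x - (w x * b x) = \int[mu]_x partial1of2 f 0 x.
  apply: eq_Rintegral => x _.
  by rewrite d1f mul0r sin0 cos0 mulr0 oppr0 sub0r mulr1.
rewrite f0 d1f0 [X in X @ _ --> _](_ : _ = fun t =>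
  t^-1 *: (\int[mu]_x f (t + 0) x - \int[mu]_x f 0 x)); last first.
  by apply/funext => t; rewrite addr0.
apply: (@cvg_differentiation_under_integral _ _ _ mu f setT measurableT
  0 (-1) 1 _ _ _ (fun x => `|w x * a x| + `|w x * b x|)) => //.
- by rewrite /= in_itv/= ltrN10 ltr01.
- move=> t _; exact: intgB (itrig a t false ia) (itrig b t true ib).
- exact: intgD (intg_norm _ _ iwa) (intg_norm _ _ iwb).
- move=> t x _ _; rewrite d1f (le_trans (ler_normB _ _))// normrN.
  by rewrite lerD// normrM ler_piMr// ?(trig_le1 true) ?(trig_le1 false).
Qed.

(** The exponential is monotonic in [b], increasing or decreasing according to
    the sign of [x]; the sum of the values at both ends covers both cases. *)
Lemma expR_le_shift (s x b : R) : `|b - s| <= 1 ->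
  expR (- (x * b)) <= expR (- (x * (s - 1))) + expR (- (x * (s + 1))).
Proof.
rewrite ler_norml => /andP[sb bs]; have [x0|x0] := leP 0 x.
  rewrite (@le_trans _ _ (expR (- (x * (s - 1)))))// ?lerDl ?expR_ge0//.
  by rewrite ler_expR lerN2 ler_wpM2l//; lra.
rewrite (@le_trans _ _ (expR (- (x * (s + 1)))))// ?lerDr ?expR_ge0//.
by rewrite ler_expR lerN2 ler_wnM2l// ?(ltW x0)//; lra.
Qed.

(** The derivative at [t] is dominated, for [|t| < 1], by the
    sum of its absolute values at [-1] and [1] ([expR_le_shift]). *)
Lemma diffquot_exp a w :
  (forall t : R, intg mu (fun x => a x * expR (- (w x * t)))) ->
  (forall t : R, intg mu (fun x => w x * a x * expR (- (w x * t)))) ->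
  t^-1 *: (\int[mu]_x (a x * expR (- (w x * t))) -
    \int[mu]_x a x) @[t --> 0^'] --> \int[mu]_x - (w x * a x).
Proof.
move=> ia iwa.
pose f (t : R) x := a x * expR (- (w x * t)).
have df (t : R) x : is_derive t 1 (f ^~ x) (- (w x * a x * expR (- (w x * t)))).
  by rewrite /f; apply: is_derive_eq; rewrite /GRing.scale/=; ring.
have d1f t x : partial1of2 f t x = - (w x * a x * expR (- (w x * t))).
  by rewrite partial1of2E; apply: derive_val.
have f0 : \int[mu]_x a x = \int[mu]_x f 0 x.
  by apply: eq_Rintegral => x _; rewrite /f mulr0 oppr0 expR0 mulr1.
have d1f0 : \int[mu]_x - (w x * a x) = \int[mu]_x partial1of2 f 0 x.
  by apply: eq_Rintegral => x _; rewrite d1f mulr0 oppr0 expR0 mulr1.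
rewrite f0 d1f0 [X in X @ _ --> _](_ : _ = fun t =>
  t^-1 *: (\int[mu]_x f (t + 0) x - \int[mu]_x f 0 x)); last first.
  by apply/funext => t; rewrite addr0.
apply: (@cvg_differentiation_under_integral _ _ _ mu f setT measurableT
  0 (-1) 1 _ _ _ (fun x => `|w x * a x * expR (- (w x * (0 - 1)))| +
                           `|w x * a x * expR (- (w x * (0 + 1)))|)) => //.
- by rewrite /= in_itv/= ltrN10 ltr01.
- by move=> t _; exact: ia.
- exact: intgD (intg_norm _ _ (iwa (0 - 1))) (intg_norm _ _ (iwa (0 + 1))).
- move=> t x /in_unit_itv t1 _; rewrite d1f normrN !normrM -mulrDr.
  rewrite ler_wpM2l ?mulr_ge0// !ger0_norm ?expR_ge0//.
  by apply: expR_le_shift; rewrite subr0.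
Qed.

End DiffUnderIntegral.

(** * The transform as a function of its parameter *)

Section KernelCoordinates.
Context {R : realType} {n : nat}.
Local Notation G := (clifford R (n + n)).
Implicit Types (a b h : G) (C : {set 'I_(n + n)}).

Lemma measurable_fprod d (T : measurableType d) (I : Type) (r : seq I)
    (u : I -> T -> R) : (forall i, measurable_fun setT (u i)) ->
  measurable_fun setT (fun x => \prod_(i <- r) u i x).
Proof.
move=> mu; elim: r => [|i r IH].
  by under eq_fun do rewrite big_nil; exact: measurable_cst.
by under eq_fun do rewrite big_cons; exact: measurable_funM.
Qed.

(** Right multiplication is linear, with the coordinates of the products of
    blades by [b] as matrix: this reduces integrals of products to real ones. *)
Lemma clmul_coord h b C : (h * b) C = \sum_A h A * (clblade A * b : G) C.
Proof.
rewrite {1}[h]clE mulr_suml sum_ffunE; apply: eq_bigr => A _.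
by rewrite -scalerAl clcoordZ.
Qed.

Lemma rotor_coord a (c : 'I_n -> R) C : (a * rotor c) C =
  \sum_(s : {ffun 'I_n -> bool})
    (\prod_i trig (s i) (c i)) * (a * bivecs s) C.
Proof.
rewrite rotorE mulr_sumr sum_ffunE; apply: eq_bigr => s _.
by rewrite -scalerAr clcoordZ.
Qed.

Lemma measurable_rotor_coord d (T : measurableType d) (c : T -> 'I_n -> R) a C :
  (forall i, measurable_fun setT (c ^~ i)) ->
  measurable_fun setT (fun x => (a * rotor (c x)) C).
Proof.
move=> mc; under eq_fun do rewrite rotor_coord.
apply: measurable_sum => s; apply: measurable_funM => //.
apply: measurable_fprod => i.
exact: measurableT_comp (measurable_trig _) (mc i).
Qed.

Lemma cvg_rotor_coord (T : Type) (F : set_system T) {FF : Filter F}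
    (c : T -> 'I_n -> R) (l : 'I_n -> R) a C :
  (forall i, c t i @[t --> F] --> l i) ->
  (a * rotor (c t)) C @[t --> F] --> (a * rotor l) C.
Proof.
move=> cl; rewrite rotor_coord; under eq_fun do rewrite rotor_coord.
apply: cvg_fsum => s _; apply: cvgM; last exact: cvg_cst.
apply: cvg_fprod => i; apply: continuous_cvg; last exact: cl.
by case: (s i); [exact: continuous_sin|exact: continuous_cos].
Qed.

Lemma rotor_coord_le a (c : 'I_n -> R) C :
  `|(a * rotor c) C| <= cl1 a * 2 ^+ n.
Proof.
rewrite (le_trans (cl1_coord _ _))// (le_trans (cl1M _ _))//.
by rewrite ler_wpM2l ?cl1_ge0// cl1_rotor.
Qed.

End KernelCoordinates.

Section ParametricIntegral.
Context {R : realType} {n : nat}.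
Local Notation G := (clifford R (n + n)).
Implicit Types (h : 'rV[R]_n -> G) (y : 'rV[R]_(n + n)) (x : 'rV[R]_n).

(** The growth condition under which the transform of [h] exists for every
    parameter. *)
Definition expint h := forall y,
  clintegrable (fun x => expR (- dotrV x (rsubmx y)) *: h x).

(** Differentiating the kernel along the [i]-th coordinate replaces [h] by this
    function, up to a constant right factor. *)
Definition coordmul (i : 'I_n) h x : G := x ord0 i *: h x.

Lemma clintegrable_sum_coord h (k : {set 'I_(n + n)} -> 'rV[R]_n -> R)
    (K : R) : clintegrable h ->
  (forall A, measurable_fun setT (k A)) -> (forall A x, `|k A x| <= K) ->
  intg dm (fun x => \sum_A h x A * k A x).
Proof.
move=> ih mk kK; apply: intg_sum => A.
by apply: (@intgM _ _ _ _ K) => //; exact: ih.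
Qed.

Lemma F2_integrandE h y x C : F2_integrand h y x C =
  \sum_A (expR (- dotrV x (rsubmx y)) *: h x) A *
    (clblade A * rotor (fun i => - (x ord0 i * y ord0 (lshift n i))) : G) C.
Proof.
by rewrite /F2_integrand clexp_NIform2 -scalerAr scalerAl clmul_coord.
Qed.

Lemma measurable_kernel_coord y (A C : {set 'I_(n + n)}) :
  measurable_fun setT (fun x =>
    (clblade A * rotor (fun i => - (x ord0 i * y ord0 (lshift n i))) : G) C).
Proof.
apply: measurable_rotor_coord => i; apply: measurableT_comp => //.
by apply: measurable_funM => //; exact: measurable_coord.
Qed.

Lemma kernel_coord_le y x (A C : {set 'I_(n + n)}) :
  `|(clblade A * rotor (fun i => - (x ord0 i * y ord0 (lshift n i))) : G) C|
    <= 2 ^+ n.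
Proof. by rewrite (le_trans (rotor_coord_le _ _ _))// cl1_blade mul1r. Qed.

Lemma F2_integrable h y : expint h -> clintegrable (F2_integrand h y).
Proof.
move=> ih C; rewrite -/(intg _ _).
apply: (intg_eq _ _ _ (fun x => esym (F2_integrandE h y x C))).
apply: (clintegrable_sum_coord _ _ (2 ^+ n)); first exact: ih.
  by move=> A; exact: measurable_kernel_coord.
by move=> A x; exact: kernel_coord_le.
Qed.

Lemma clintegrable_mulr h (b : G) :
  clintegrable h -> clintegrable (fun x => h x * b).
Proof.
move=> ih C; apply: (intg_eq _ _ _ (fun x => esym (clmul_coord _ _ C))).
apply: (clintegrable_sum_coord _ _ (cl1 b)) => // A x.
by rewrite (le_trans (cl1_coord _ _))// (le_trans (cl1M _ _))// cl1_blade mul1r.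
Qed.

Lemma clint_mulr h (b : G) :
  clintegrable h -> clint (fun x => h x * b) = clint h * b.
Proof.
move=> ih; apply/ffunP => C; rewrite ffunE clmul_coord.
under eq_Rintegral do rewrite clmul_coord.
rewrite Rintegral_fsum; last first.
  move=> A; apply: (@intgM _ _ _ _ (cl1 b));
    [exact: ih|exact: measurable_cst|move=> x].
  rewrite (le_trans (cl1_coord _ _))// (le_trans (cl1M _ _))//.
  by rewrite cl1_blade mul1r.
apply: eq_bigr => A _; rewrite RintegralZr//; last exact: ih.
by rewrite ffunE.
Qed.

Lemma rV_coord_le (m : nat) (v : 'rV[R]_m) (j : 'I_m) : `|v ord0 j| <= `|v|.
Proof.
rewrite [leRHS]/Num.Def.normr/= mx_normrE; apply/bigmax_geP; right.
by exists (ord0, j).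
Qed.

Definition unit_shift y (s : {ffun 'I_n -> bool}) : 'rV[R]_(n + n) :=
  row_mx 0 (\row_i (y ord0 (rshift n i) + (if s i then 1 else - 1))).

Lemma expR_dotrV_unit_shift x (s : {ffun 'I_n -> bool}) y :
  expR (- dotrV x (rsubmx (unit_shift y s))) =
  \prod_i (expR (- (x ord0 i * (y ord0 (rshift n i) +
    (if s i then 1 else - 1))))).
Proof.
rewrite row_mxKr /dotrV -sumrN expR_sum; apply: eq_bigr => i _.
by rewrite mxE.
Qed.

(** A local bound by finitely many values of the weight: integrability at each
    single parameter thus gives domination that is uniform near [y]. *)
Lemma expR_dotrV_le y y' x : `|y' - y| <= 1 ->
  expR (- dotrV x (rsubmx y')) <= \sum_(s : {ffun 'I_n -> bool})
    expR (- dotrV x (rsubmx (unit_shift y s))).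
Proof.
move=> yy'; under eq_bigr do rewrite expR_dotrV_unit_shift.
rewrite -(bigA_distr_bigA (fun (i : 'I_n) (b : bool) =>
  expR (- (x ord0 i * (y ord0 (rshift n i) + (if b then 1 else - 1)))))).
rewrite /dotrV -sumrN expR_sum; apply: ler_prod => i _; rewrite expR_ge0/=.
rewrite big_bool/= addrC mxE; apply: expR_le_shift.
rewrite (le_trans _ yy')//.
by have := rV_coord_le _ (y' - y) (rshift n i); rewrite !mxE.
Qed.

Lemma cvg_clint (T : Type) (F : set_system T) {FF : Filter F}
    (u : T -> 'rV[R]_n -> G) (l : 'rV[R]_n -> G) :
  (forall C, \int[dm]_x u t x C @[t --> F] --> \int[dm]_x l x C) ->
  clint (u t) @[t --> F] --> clint l.
Proof.
move=> ul; apply/clcvgP => C.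
by rewrite ffunE; under eq_fun do rewrite ffunE; exact: ul.
Qed.

Lemma continuous_F2 h : expint h -> continuous (F2 h).
Proof.
move=> ih y; apply: (@cvg_clint _ _ (nbhs_filter y)) => C.
apply: cvg_unit_seq => w wy w1.
pose dom x := \sum_s \sum_A
  `|(expR (- dotrV x (rsubmx (unit_shift y s))) *: h x) A| * 2 ^+ n.
apply: (proj2 (Rintegral_dct dm (fun k x => F2_integrand h (w k) x C) _ dom
  _ _ _ _)).
- by move=> k; apply: intg_measurable; exact: F2_integrable.
- apply: intg_sum => s; apply: intg_sum => A.
  apply: (intg_eq _ _ _ (fun x => mulrC _ _)).
  by apply/intgZ/intg_norm; exact: ih.
- move=> k x; rewrite F2_integrandE (le_trans (ler_norm_sum _ _ _))//.
  rewrite /dom exchange_big/=; apply: ler_sum => A _.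
  rewrite normrM -mulr_suml ler_pM//; last exact: kernel_coord_le.
  rewrite clcoordZ normrM ger0_norm ?expR_ge0//.
  under eq_bigr do rewrite clcoordZ normrM ger0_norm ?expR_ge0//.
  by rewrite -mulr_suml ler_wpM2r//; exact: expR_dotrV_le.
- move=> x; rewrite [X in _ --> X]F2_integrandE.
  under eq_fun => k do rewrite (F2_integrandE h (w k) x C).
  have wj j : w k ord0 j @[k --> \oo] --> y ord0 j.
    exact: (cvg_comp w (fun v : 'rV[R]_(n + n) => v ord0 j) wy
      (@coord_continuous _ _ _ ord0 j y)).
  apply: cvg_fsum => A _; apply: cvgM; last first.
    by apply: cvg_rotor_coord => i; apply: cvgN; apply: cvgM;
      [exact: cvg_cst|exact: wj].
  rewrite clcoordZ; under eq_fun do rewrite clcoordZ.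
  apply: cvgM; last exact: cvg_cst.
  apply: continuous_cvg; first exact: continuous_expR.
  apply: cvgN; apply: cvg_fsum => i _; apply: cvgM; first exact: cvg_cst.
  by rewrite mxE; under eq_fun do rewrite mxE; exact: wj.
Qed.

End ParametricIntegral.

(** * Partial derivatives and monogenicity *)

Section Monogenicity.
Context {R : realType} {n : nat}.
Local Notation G := (clifford R (n + n)).
Implicit Types (h : 'rV[R]_n -> G) (y : 'rV[R]_(n + n)) (x : 'rV[R]_n).

Lemma F2_integrand_coordmul i h y x :
  F2_integrand (coordmul i h) y x = x ord0 i *: F2_integrand h y x.
Proof. by rewrite /F2_integrand -scalerAl. Qed.

Lemma F2_integrand_lshift h y x (i : 'I_n) (t : R) :
  F2_integrand h (t *: delta_mx ord0 (lshift n i) + y) x =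
  F2_integrand h y x *
    ((cos (t * x ord0 i))%:A - sin (t * x ord0 i) *: bivec i).
Proof.
rewrite /F2_integrand !clexp_NIform2 -!scalerAr -scalerAl -mulrA.
congr (_ *: _).
  congr (expR (- _)); apply: eq_bigr => j _; rewrite !mxE eqxx/=.
  by rewrite eq_sym (negPf (lshift_neq_rshift _ _)) mulr0 add0r.
congr (_ * _); rewrite -cosN -[- (sin _ *: _)]scaleNr -sinN -rotor_shift.
congr rotor; apply/funext => j; rewrite !mxE eqxx/= eq_shift.
case: eqP => [->|_]; last by rewrite mulr0 add0r addr0.
by rewrite mulr1 mulrDr opprD addrC [t * _]mulrC.
Qed.

Lemma F2_integrand_rshift h y x (i : 'I_n) (t : R) :
  F2_integrand h (t *: delta_mx ord0 (rshift n i) + y) x =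
  expR (- (x ord0 i * t)) *: F2_integrand h y x.
Proof.
rewrite /F2_integrand !clexp_NIform2 -!scalerAr scalerA -expRD; congr (_ *: _).
  congr expR; rewrite /dotrV (bigD1 i)//= [in RHS](bigD1 i)//= !mxE !eqxx/=.
  rewrite mulr1 mulrDr !opprD addrA; congr (_ - _).
  apply: eq_bigr => j /negPf ji; rewrite !mxE eqxx/= eq_shift ji.
  by rewrite mulr0 add0r.
congr (_ * rotor _); apply/funext => j; rewrite !mxE eqxx/=.
by rewrite (negPf (lshift_neq_rshift _ _)) mulr0 add0r.
Qed.

Lemma diffquot_clint (u : R -> 'rV[R]_n -> G) (u0 l : 'rV[R]_n -> G) :
  (forall C, t^-1 *: (\int[dm]_x u t x C - \int[dm]_x u0 x C) @[t --> 0^']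
    --> \int[dm]_x l x C) ->
  t^-1 *: (clint (u t) - clint u0) @[t --> 0^'] --> clint l.
Proof.
move=> ul; apply/clcvgP => C; rewrite ffunE.
under eq_fun do rewrite clcoordZ clcoordD clcoordN !ffunE.
exact: ul.
Qed.

Lemma cvg_is_derive (F : 'rV[R]_(n + n) -> G) (y v : 'rV[R]_(n + n)) (l : G) :
  t^-1 *: (F (t *: v + y) - F y) @[t --> 0^'] --> l -> is_derive y v F l.
Proof.
move=> Fl; apply: DeriveDef; first exact: cvgP Fl.
exact: cvg_lim Fl.
Qed.

Lemma is_derive_F2_left h y (i : 'I_n) : expint h -> expint (coordmul i h) ->
  is_derive y (delta_mx ord0 (lshift n i)) (F2 h)
    (F2 (coordmul i h) y * - bivec i).
Proof.
move=> ih iih; apply: cvg_is_derive.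
rewrite /F2 -clint_mulr; last exact: F2_integrable.
apply: diffquot_clint => C.
have mw : measurable_fun setT (fun x : 'rV[R]_n => x ord0 i).
  exact: measurable_coord.
have ib := clintegrable_mulr _ (bivec i) (F2_integrable h y ih) C.
have iwb := clintegrable_mulr _ (bivec i) (F2_integrable _ y iih) C.
have ia := F2_integrable h y ih C; have iwa := F2_integrable _ y iih C.
have wbE x : (F2_integrand (coordmul i h) y x * bivec i) C =
    x ord0 i * (F2_integrand h y x * bivec i) C.
  by rewrite F2_integrand_coordmul -scalerAl clcoordZ.
have waE x : F2_integrand (coordmul i h) y x C =
    x ord0 i * F2_integrand h y x C.
  by rewrite F2_integrand_coordmul clcoordZ.
have := diffquot_trig dm (fun x => F2_integrand h y x C)
  (fun x => (F2_integrand h y x * bivec i) C) (fun x => x ord0 i) mw ia ib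
  (intg_eq _ _ _ waE iwa) (intg_eq _ _ _ wbE iwb).
rewrite (_ : \int[dm]_x - _ = \int[dm]_x
    (F2_integrand (coordmul i h) y x * - bivec i) C); last first.
  by apply: eq_Rintegral => x _; rewrite mulrN clcoordN [in RHS](wbE x).
apply: cvg_trans; apply: near_eq_cvg; apply: nearW => t.
congr (_ *: (_ - _)); apply: eq_Rintegral => x _.
rewrite F2_integrand_lshift mulrBr clcoordD clcoordN -!scalerAr mulr1 !clcoordZ.
by congr (_ - _); rewrite mulrC.
Qed.

Lemma is_derive_F2_right h y (i : 'I_n) : expint h -> expint (coordmul i h) ->
  is_derive y (delta_mx ord0 (rshift n i)) (F2 h) (F2 (coordmul i h) y * - 1).
Proof.
move=> ih iih; apply: cvg_is_derive.
rewrite /F2 -clint_mulr; last exact: F2_integrable.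
apply: diffquot_clint => C.
have shiftE h' t x : F2_integrand h' (t *: delta_mx ord0 (rshift n i) + y) x C =
    F2_integrand h' y x C * expR (- (x ord0 i * t)).
  by rewrite F2_integrand_rshift clcoordZ mulrC.
have waE x : F2_integrand (coordmul i h) y x C =
    x ord0 i * F2_integrand h y x C.
  by rewrite F2_integrand_coordmul clcoordZ.
have ia t := intg_eq _ _ _ (shiftE h t)
  (F2_integrable h (t *: delta_mx ord0 (rshift n i) + y) ih C).
have iwa t : intg dm (fun x => x ord0 i * F2_integrand h y x C *
    expR (- (x ord0 i * t))).
  apply: (intg_eq _ _ _ _ (F2_integrable _
    (t *: delta_mx ord0 (rshift n i) + y) iih C)) => x.
  by rewrite [LHS](shiftE (coordmul i h) t x) [in LHS](waE x).
have := diffquot_exp dm (fun x => F2_integrand h y x C)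
  (fun x => x ord0 i) ia iwa.
rewrite (_ : \int[dm]_x - _ = \int[dm]_x
    (F2_integrand (coordmul i h) y x * - 1) C); last first.
  by apply: eq_Rintegral => x _; rewrite mulrN mulr1 clcoordN [in RHS](waE x).
apply: cvg_trans; apply: near_eq_cvg; apply: nearW => t.
congr (_ *: (_ - _)); apply: eq_Rintegral => x _; exact/esym/shiftE.
Qed.

(** The derivatives along [e_i] and [e'_i] are right multiples of the same
    transform, by [- bivec i] and [- 1]; [bivec_el] makes their contributions
    to the Dirac operator cancel. *)
Lemma right_monogenic_F2 h : expint h -> (forall i, expint (coordmul i h)) ->
  right_monogenic setT (F2 h).
Proof.
move=> ih iih; split=> [k|y _].
  have [i [b dF]] : exists i b, forall y,
      is_derive y (delta_mx ord0 k) (F2 h) (F2 (coordmul i h) y * b).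
    case: (split_ordP k) => i ->; exists i.
      by exists (- bivec i) => y; exact: is_derive_F2_left.
    by exists (- 1) => y; exact: is_derive_F2_right.
  split=> y _; first by have [] := dF y.
  have -> : 'D_(delta_mx ord0 k) (F2 h) = fun y => F2 (coordmul i h) y * b.
    by apply/funext => z; have /@derive_val := dF z.
  apply: (@clcvgM _ _ _ _ (nbhs_filter y)); last exact: cvg_cst.
  exact: continuous_F2.
rewrite /right_dirac big1// => i _.
have /@derive_val -> := is_derive_F2_left h y i ih (iih i).
have /@derive_val -> := is_derive_F2_right h y i ih (iih i).
by rewrite -!mulrA -mulrDr mulNr bivec_el opprK mulN1r subrr mulr0.
Qed.

End Monogenicity.

(** * The Poisson kernel on the line *)

Section PoissonKernel.
Context {R : realType}.
Notation mu := (@lebesgue_measure R).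
Implicit Types (e u t a b x : R).

(** The weight of Abel summation; its cosine transform is [poisson e]. *)
Definition abel e x : R := expR (- (e * `|x|)).

Definition poisson e u : R := 2 * e / (e ^+ 2 + u ^+ 2).

Lemma abel_ge0 e x : 0 <= abel e x. Proof. exact: expR_ge0. Qed.

Lemma abel_le1 e x : 0 < e -> abel e x <= 1.
Proof. by move=> e0; rewrite -expR0 ler_expR oppr_le0 mulr_ge0// ltW. Qed.

Lemma continuous_abel e : continuous (abel e).
Proof.
move=> x; apply: continuous_cvg; first exact: continuous_expR.
by apply: cvgN; apply: cvgM; [exact: cvg_cst|exact: norm_continuous].
Qed.

Lemma measurable_abel e : measurable_fun [set: R] (abel e).
Proof. by apply: continuous_measurable_fun; exact: continuous_abel. Qed.

Lemma sum_sqr_gt0 e u : 0 < e -> 0 < e ^+ 2 + u ^+ 2.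
Proof. by move=> e0; rewrite ltr_wpDr ?sqr_ge0// exprn_gt0. Qed.

Lemma continuous_trig (d : bool) : continuous (trig d : R -> R).
Proof. by case: d; [exact: continuous_sin|exact: continuous_cos]. Qed.

Lemma continuous_trig_mul (d : bool) u :
  continuous (fun x : R => trig d (u * x)).
Proof.
move=> x; apply: (@continuous_comp _ _ _ (fun x : R => u * x) (trig d)).
  exact: mulrl_continuous.
exact: continuous_trig.
Qed.

(** Adding [1] to the cosine makes the integrand nonnegative, so that the
    fundamental theorem of calculus on a half-line applies and yields
    integrability as well; the case [u = 0] later removes the extra term. *)
Lemma integral_abel_halfline e u : 0 < e ->
  (\int[mu]_(x in `[0%R, +oo[) (expR (- (e * x)) * (1 + cos (u * x)))%:E =
    (e^-1 + e / (e ^+ 2 + u ^+ 2))%:E)%E.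
Proof.
move=> e0; set s := e ^+ 2 + u ^+ 2.
have s0 : 0 < s by exact: sum_sqr_gt0.
pose k x := - e^-1 + s^-1 * (u * sin (u * x) - e * cos (u * x)).
pose F x := expR (- (e * x)) * k x.
have dF x : is_derive x 1 F (expR (- (e * x)) * (1 + cos (u * x))).
  rewrite /F /k; apply: is_derive_eq; rewrite /GRing.scale/=.
  have {}s0 : s != 0 by rewrite gt_eqF.
  have {}e0 : e != 0 by rewrite gt_eqF.
  rewrite /s in s0 *; field.
  by rewrite s0.
have cexp : continuous (fun x => expR (- (e * x))).
  move=> z; apply: (@continuous_comp _ _ _ (fun x : R => - (e * x)) expR).
    by apply: cvgN; exact: mulrl_continuous.
  exact: continuous_expR.
have cf : continuous (fun x => expR (- (e * x)) * (1 + cos (u * x))).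
  move=> z; apply: cvgM; first exact: cexp.
  by apply: cvgD; [exact: cvg_cst|exact: (continuous_trig_mul false)].
have expF : expR (- (e * x)) @[x --> +oo%R] --> (0 : R).
  apply: (cvg_comp (fun x => e * x) (fun x => expR (- x))) (@cvgr_expR R).
  exact: gt0_cvgMry.
rewrite (@ge0_continuous_FTC2y _ _ F _ 0).
- by rewrite /F mulr0 oppr0 expR0 /k mulr0 sin0 cos0 mulr0 sub0r mulr1 mul1r
    -EFinB sub0r opprD opprK mulrN opprK [s^-1 * _]mulrC.
- by move=> x _; rewrite mulr_ge0 ?expR_ge0// -lerBlDl sub0r cos_geN1.
- exact: continuous_subspaceT.
- pose K := e^-1 + s^-1 * (`|u| + e).
  have kK x : `|k x| <= K.
    rewrite /k /K (le_trans (ler_normD _ _))// normrN gtr0_norm ?invr_gt0//.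
    rewrite lerD2l normrM gtr0_norm ?invr_gt0// ler_wpM2l ?invr_ge0 ?(ltW s0)//.
    rewrite (le_trans (ler_normB _ _))// lerD// normrM ?(gtr0_norm e0).
      by rewrite ler_piMr// (trig_le1 true).
    by rewrite ler_piMr ?(ltW e0)// (trig_le1 false).
  apply: norm_cvg0.
  apply: (@squeeze_cvgr _ _ _ _ (fun=> 0) (fun x => expR (- (e * x)) * K)).
  + apply: nearW => x; rewrite normr_ge0/= normrM ger0_norm ?expR_ge0//.
    by rewrite ler_wpM2l ?expR_ge0.
  + exact: cvg_cst.
  + by rewrite -[X in _ --> X](mul0r K); apply: cvgM => //; exact: cvg_cst.
- by move=> x _; have [] := dF x.
- apply: cvg_at_right_filter.
  apply: differentiable_continuous; apply/derivable1_diffP.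
  by have [] := dF 0.
- by move=> x _; rewrite derive1E; have /@derive_val := dF x.
Qed.

Lemma integral_abel_cos_ge0 e u : 0 < e ->
  (\int[mu]_x (abel e x * (1 + cos (u * x)))%:E =
    (2 * (e^-1 + e / (e ^+ 2 + u ^+ 2)))%:E)%E.
Proof.
move=> e0; rewrite ge0_symfun_integralT.
- rewrite -set_itvcy EFinM; congr (_ * _)%E.
  rewrite -(integral_abel_halfline e u e0); apply: eq_integral => x.
  by rewrite inE/= in_itv/= andbT => x0; rewrite /abel ger0_norm.
- by move=> x; rewrite mulr_ge0 ?abel_ge0// -lerBlDl sub0r cos_geN1.
- move=> x; apply: cvgM; first exact: continuous_abel.
  by apply: cvgD; [exact: cvg_cst|exact: (continuous_trig_mul false)].
- by move=> x /=; rewrite /abel normrN mulrN cosN.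
Qed.

Lemma intg_abel e : 0 < e -> intg mu (abel e).
Proof.
move=> e0; apply/integrableP; split.
  by apply/measurable_EFinP; exact: measurable_abel.
apply: (@le_lt_trans _ _ (\int[mu]_x (abel e x * (1 + cos (0 * x)))%:E)%E).
  apply: ge0_le_integral => //.
  - apply/measurableT_comp => //.
    by apply/measurable_EFinP; exact: measurable_abel.
  - apply/measurable_EFinP/measurable_funM; first exact: measurable_abel.
    by apply: measurable_funD => //; under eq_fun do rewrite mul0r;
      exact: measurable_cst.
  - move=> x _ /=; rewrite lee_fin mul0r cos0 ger0_norm ?abel_ge0//.
    by rewrite ler_peMr ?abel_ge0// lerDl.
by rewrite integral_abel_cos_ge0// ltry.
Qed.

Lemma intg_abel_trig e (d : bool) u : 0 < e ->
  intg mu (fun x => abel e x * trig d (u * x)).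
Proof.
move=> e0; apply: (@intgM _ _ _ _ 1); first exact: intg_abel.
  by apply: continuous_measurable_fun; exact: continuous_trig_mul.
by move=> x; exact: trig_le1.
Qed.

Lemma Rintegral_abel_1cos e u : 0 < e ->
  \int[mu]_x abel e x + \int[mu]_x (abel e x * cos (u * x)) =
  2 * (e^-1 + e / (e ^+ 2 + u ^+ 2)).
Proof.
move=> e0; rewrite -RintegralD//.
- rewrite /Rintegral -[RHS]/(fine _%:E) -integral_abel_cos_ge0//.
  by congr fine; apply: eq_integral => x _; rewrite mulrDr mulr1.
- exact: intg_abel.
- exact: (intg_abel_trig _ false).
Qed.

Lemma Rintegral_abel_cos e u : 0 < e ->
  \int[mu]_x (abel e x * cos (u * x)) = poisson e u.
Proof.
move=> e0; have := Rintegral_abel_1cos e u e0.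
have := Rintegral_abel_1cos e 0 e0.
have -> : \int[mu]_x (abel e x * cos (0 * x)) = \int[mu]_x abel e x.
  by apply: eq_Rintegral => x _; rewrite mul0r cos0 mulr1.
rewrite expr0n addr0 /poisson => intw.
have -> : \int[mu]_x abel e x = 2 / e.
  have {}e0 : e != 0 by rewrite gt_eqF.
  have : \int[mu]_x abel e x + \int[mu]_x abel e x = 2 / e + 2 / e.
    by rewrite intw; field.
  by move=> ww; lra.
by rewrite mulrDr => /addrI ->; rewrite mulrA.
Qed.

(** Each half-line is mapped to the other by substitution. *)
Lemma ge0_integral_opp (g : R -> R) : (forall x, 0 <= g x) -> continuous g ->
  (\int[mu]_x (g (- x))%:E = \int[mu]_x (g x)%:E)%E.
Proof.
move=> g0 cg.
have split0 (f : R -> R) : (forall x, 0 <= f x) -> continuous f ->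
    (\int[mu]_x (f x)%:E = \int[mu]_(x in `[0%R, +oo[) (f x)%:E +
                           \int[mu]_(x in `[0%R, +oo[) (f (- x))%:E)%E.
  move=> f0 cf.
  have mf : measurable_fun [set: R] f by exact: continuous_measurable_fun.
  rewrite -(setUv `[0%R, +oo[%classic) ge0_integral_setU//= ; last 4 first.
    by apply: measurableC.
    by apply/measurable_EFinP; rewrite setUv.
    by move=> x _; rewrite lee_fin.
    exact/disj_setPCl.
  congr (_ + _)%E; rewrite setCitvr.
  rewrite integral_itv_bndo_bndc; last exact/measurable_EFinP/measurable_funTS.
  rewrite -{1}oppr0 ge0_integration_by_substitutionNy//.
  exact: continuous_subspaceT.
have cgN : continuous (fun x => g (- x)).
  move=> x; apply: (@continuous_comp _ _ _ (fun x : R => - x) g).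
    exact: opp_continuous.
  exact: cg.
rewrite (split0 g)// (split0 (fun x => g (- x)))// addeC.
by under [X in (X + _)%E]eq_integral do rewrite opprK.
Qed.

(** An odd integrand; the reflection is applied to the nonnegative function
    obtained by adding [1] to the sine. *)
Lemma Rintegral_abel_sin e u : 0 < e ->
  \int[mu]_x (abel e x * sin (u * x)) = 0.
Proof.
move=> e0; pose g x := abel e x * (1 + sin (u * x)).
have g0 x : 0 <= g x.
  by rewrite mulr_ge0 ?abel_ge0// -lerBlDl sub0r sin_geN1.
have cg : continuous g.
  move=> x; apply: cvgM; first exact: continuous_abel.
  by apply: cvgD; [exact: cvg_cst|exact: (continuous_trig_mul true)].
have := congr1 fine (ge0_integral_opp g g0 cg).
have gE : \int[mu]_x g x =
    \int[mu]_x abel e x + \int[mu]_x (abel e x * sin (u * x)).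
  rewrite -RintegralD//; [|exact: intg_abel|exact: (intg_abel_trig _ true)].
  by apply: eq_Rintegral => x _; rewrite /g mulrDr mulr1.
have gNE : \int[mu]_x g (- x) =
    \int[mu]_x abel e x - \int[mu]_x (abel e x * sin (u * x)).
  rewrite -RintegralB//; [|exact: intg_abel|exact: (intg_abel_trig _ true)].
  apply: eq_Rintegral => x _.
  by rewrite /g /abel normrN mulrN sinN mulrDr mulr1 mulrN.
rewrite -[LHS]/(\int[mu]_x g (- x)) -[RHS]/(\int[mu]_x g x) gE gNE.
by move=> /addrI/eqP; rewrite eq_sym -addr_eq0 -mulr2n mulrn_eq0/= => /eqP.
Qed.

End PoissonKernel.

(** * Product measures and Lebesgue measure on row vectors *)

Section ProductIntegrals.
Context {R : realType} {d1 d2 : measure_display}.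
Context {T1 : measurableType d1} {T2 : measurableType d2}.
Variables (m1 : {sigma_finite_measure set T1 -> \bar R}).
Variables (m2 : {sigma_finite_measure set T2 -> \bar R}).

Lemma Rintegral_EFin d (T : measurableType d) (mu : {measure set T -> \bar R})
    (u : T -> R) : intg mu u ->
  (\int[mu]_x u x)%:E = (\int[mu]_x (u x)%:E)%E.
Proof. by move=> iu; rewrite /Rintegral fineK//; exact: integrable_fin_num. Qed.

Lemma intg_prod_measure (u : T1 -> R) (v : T2 -> R) : intg m1 u -> intg m2 v ->
  intg (m1 \x m2)%E (fun p => u p.1 * v p.2).
Proof.
move=> iu iv.
have mu : measurable_fun setT u by exact: intg_measurable iu.
have mv : measurable_fun setT v by exact: intg_measurable iv.
apply/integrable12ltyP.
  apply/measurable_EFinP/measurable_funM.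
    exact: measurableT_comp mu measurable_fst.
  exact: measurableT_comp mv measurable_snd.
have inner x : (\int[m2]_y `|(u x * v y)%:E| =
    (`|u x| * \int[m2]_y `|v y|)%:E)%E.
  rewrite -RintegralZl//; last exact: intg_norm.
  rewrite Rintegral_EFin; last by apply: intgZ; exact: intg_norm.
  by apply: eq_integral => y _ /=; rewrite normrM.
under eq_integral do rewrite inner.
rewrite -Rintegral_EFin ?ltry//.
apply: (intg_eq _ _ _ (fun x => mulrC _ _)).
by apply: intgZ; exact: intg_norm.
Qed.

Variable h : T1 * T2 -> R.
Hypothesis ih : intg (m1 \x m2)%E h.
Hypothesis ih1 : forall x, intg m2 (fun y => h (x, y)).
Hypothesis ih2 : forall y, intg m1 (fun x => h (x, y)).

(** Integrability of every section, not only of almost every one, keeps the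
    inner integrals real, so that Fubini's theorem holds for [Rintegral]. *)
Lemma Rintegral12_prod :
  intg m1 (fun x => \int[m2]_y h (x, y)) /\
  \int[m1]_x \int[m2]_y h (x, y) = \int[(m1 \x m2)%E]_z h z.
Proof.
have FE : EFin \o (fun x => \int[m2]_y h (x, y)) = fubini_F m2 (EFin \o h).
  by apply/funext => x; rewrite /= Rintegral_EFin.
split; first by rewrite /intg FE; exact: integrable_fubini_F.
rewrite /Rintegral -(integral12_prod_meas1 ih) -FE.
by congr fine; apply: eq_integral => x _ /=; rewrite Rintegral_EFin.
Qed.

Lemma Rintegral21_prod :
  \int[m2]_y \int[m1]_x h (x, y) = \int[(m1 \x m2)%E]_z h z.
Proof.
rewrite /Rintegral -(integral21_prod_meas1 ih).
congr fine; apply: eq_integral => y _.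
by rewrite -[LHS]/((\int[m1]_x h (x, y))%:E) Rintegral_EFin.
Qed.

End ProductIntegrals.

Section RowIntegrals.
Context {R : realType}.
Notation mu := (@lebesgue_measure R).

Lemma intg_rVcons n (u : 'rV[R]_n.+1 -> R) : measurable_fun setT u ->
  intg (mu \x lebesgue_rV n)%E (fun p => u (rVcons p)) ->
  intg (lebesgue_rV n.+1) u /\
  \int[lebesgue_rV n.+1]_v u v = \int[(mu \x lebesgue_rV n)%E]_p u (rVcons p).
Proof.
move=> mu_ iu.
have me : measurable_fun setT (EFin \o u) by exact/measurable_EFinP.
have ie : (mu \x lebesgue_rV n)%E.-integrable (@rVcons R n @^-1` setT)
    ((EFin \o u) \o @rVcons R n) by rewrite preimage_setT.
split; first exact: (integrable_pushforward (@measurable_rVcons R n) me ie).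
have := integral_pushforward (@measurable_rVcons R n) me ie measurableT.
by rewrite preimage_setT /Rintegral => <-.
Qed.

(** Fubini's theorem for functions with separated variables, by induction on the
    dimension along the recursive construction of the measure. *)
Lemma rV_prod_integral n (phi : 'I_n -> R -> R) :
  (forall i, intg mu (phi i)) ->
  intg (lebesgue_rV n) (fun v => \prod_i phi i (v ord0 i)) /\
  \int[lebesgue_rV n]_v \prod_i phi i (v ord0 i) = \prod_i \int[mu]_x phi i x.
Proof.
elim: n phi => [|n IH] phi iphi.
  have -> : (fun v : 'rV[R]_0 => \prod_i phi i (v ord0 i)) = cst 1.
    by apply/funext => v; rewrite big_ord0.
  have mass1 : lebesgue_rV 0 [set: 'rV[R]_0] = 1%E by rewrite /= diracT.
  split; last first.
    by rewrite big_ord0 Rintegral_cst// mul1r; exact: (congr1 fine mass1).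
  apply/integrableP; split; first exact/measurable_EFinP.
  rewrite (eq_integral (cst 1%E)) => [|x _ /=]; last by rewrite normr1.
  have : (lebesgue_rV 0 [set: 'rV[R]_0] < +oo)%E by rewrite mass1 ltry.
  by rewrite integral_cst// mul1e.
have [iIH intIH] := IH (fun i => phi (lift ord0 i)) (fun i => iphi _).
have mphi i : measurable_fun setT (phi i) by exact: intg_measurable (iphi i).
have mprod : measurable_fun setT
    (fun v : 'rV[R]_n.+1 => \prod_i phi i (v ord0 i)).
  by apply: measurable_fprod => i; exact: measurableT_comp (measurable_coord i).
have prodE (p : measurableTypeR R * 'rV[R]_n) :
    \prod_i phi i (rVcons p ord0 i) =
    phi ord0 p.1 * \prod_i phi (lift ord0 i) (p.2 ord0 i).
  rewrite big_ord_recl rVcons0; congr (_ * _).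
  by apply: eq_bigr => i _; rewrite rVconsS.
have ip := intg_prod_measure mu (lebesgue_rV n) _ _ (iphi ord0) iIH.
have [iu intu] := intg_rVcons _ _ mprod
  (intg_eq _ _ _ (fun p => esym (prodE p)) ip).
split=> //; rewrite intu; under eq_Rintegral do rewrite prodE.
have ip1 (x : measurableTypeR R) : intg (lebesgue_rV n)
    (fun y => phi ord0 x * \prod_i phi (lift ord0 i) (y ord0 i)).
  exact: intgZ.
have [_ <-] := Rintegral12_prod mu (lebesgue_rV n) _ ip ip1.
rewrite big_ord_recl -intIH -RintegralZr//; last exact: iphi.
by apply: eq_Rintegral => x _ /=; rewrite RintegralZl.
Qed.

(** A hyperplane is a box with one degenerate side, hence a null set. *)
Lemma ae_coord_neq n (i : 'I_n) (a : R) :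
  {ae lebesgue_rV n, forall v : 'rV[R]_n, v ord0 i <> a}.
Proof.
pose A (j : 'I_n) : set R := if j == i then [set a] else setT.
have mA j : measurable (A j) by rewrite /A; case: ifP.
exists [set v : 'rV[R]_n | forall j, A j (v ord0 j)]; split.
- rewrite [X in measurable X](_ : _ = \bigcap_(j in [set: 'I_n])
      (fun v : 'rV[R]_n => v ord0 j) @^-1` A j); last first.
    by apply/seteqP; split => [v vA j _|v vA j]; [exact: vA|exact: (vA j)].
  apply: fin_bigcap_measurable => // j _.
  by rewrite -[X in measurable X]setTI; exact: measurable_coord.
- rewrite (lebesgue_rV_box mA) (bigD1 i)//= /A eqxx.
  by rewrite lebesgue_measure_set1 mul0e.
- move=> v /= /contrapT via j; rewrite /A; case: eqP => // ->.
  by rewrite /= via.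
Qed.

Section Normalization.
Context {n : nat}.
Implicit Types u : 'rV[R]_n -> R.

(** The density of [dm] with respect to [lebesgue_rV n]. *)
Definition dm_density : R := (2 * pi) `^ (- (n%:R / 2)).

Lemma ge0_integral_dm (g : 'rV[R]_n -> \bar R) : measurable_fun setT g ->
  (forall x, 0 <= g x)%E ->
  (\int[dm]_x g x = dm_density%:E * \int[lebesgue_rV n]_x g x)%E.
Proof. by move=> mg g0; rewrite ge0_integral_mscale. Qed.

Lemma intg_dm u : intg (lebesgue_rV n) u -> intg dm u.
Proof.
move=> iu; have /integrableP[mu_ u_oo] := iu.
apply/integrableP; split=> //; rewrite ge0_integral_dm//; last first.
  exact: measurableT_comp.
by rewrite lte_mul_pinfty// lee_fin powR_ge0.
Qed.

Lemma intg_lebesgue u : intg dm u -> intg (lebesgue_rV n) u.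
Proof.
move=> iu; have /integrableP[mu_ u_oo] := iu.
apply/integrableP; split=> //; move: u_oo.
rewrite ge0_integral_dm//; last first.
  exact: measurableT_comp.
have c0 : (0 < dm_density%:E :> \bar R)%E.
  by rewrite lte_fin powR_gt0// mulr_gt0// pi_gt0.
rewrite ltNge => /negP coo; rewrite ltNge leye_eq; apply/eqP => uoo.
by apply: coo; rewrite uoo gt0_muley.
Qed.

Lemma Rintegral_dm u : intg (lebesgue_rV n) u ->
  \int[dm]_x u x = dm_density * \int[lebesgue_rV n]_x u x.
Proof.
move=> iu; rewrite /Rintegral.
rewrite integralE [in RHS]integralE.
have mu_ : measurable_fun setT (EFin \o u) by exact: measurable_int iu.
rewrite !ge0_integral_dm//; last 2 first.
  exact: measurable_funeneg.
  exact: measurable_funepos.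
have := integrable_pos_fin_num measurableT iu.
have := integrable_neg_fin_num measurableT iu.
move=> /fineK <- /fineK <-.
by rewrite -!EFinM -!EFinB/= mulrBr.
Qed.

Lemma dm_density_sqr : dm_density * dm_density * (2 * pi) ^+ n = 1.
Proof.
have pi2 : 0 < 2 * pi :> R by rewrite mulr_gt0// pi_gt0.
rewrite /dm_density -powRD; last by rewrite (gt_eqF pi2) implybT.
rewrite -opprD -splitr powRN powR_mulrn ?ltW//.
by rewrite mulVf// expf_neq0// gt_eqF.
Qed.

End Normalization.

End RowIntegrals.

(** * Averages of the Poisson kernel over a segment *)

Section PoissonOnSegments.
Context {R : realType}.
Notation mu := (@lebesgue_measure R).
Implicit Types (e u t a b x y : R).

Definition seg a b : R -> R := \1_(`[a, b]%classic : set R).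

Lemma segE a b x : seg a b x = (a <= x <= b)%R%:R.
Proof. by rewrite /seg indicE mem_setE in_itv. Qed.

Lemma seg_ge0 a b x : 0 <= seg a b x.
Proof. by rewrite segE ler0n. Qed.

Lemma seg_le1 a b x : seg a b x <= 1.
Proof. by rewrite segE; case: (_ && _); rewrite ?lexx ?ler01. Qed.

Lemma measurable_seg a b : measurable_fun [set: R] (seg a b).
Proof. exact: measurable_indic. Qed.

Lemma intg_seg a b : intg mu (seg a b).
Proof. exact: integrable_indic_itv. Qed.

Lemma Rintegral_seg a b : a <= b -> \int[mu]_x seg a b x = b - a.
Proof.
move=> ab; rewrite /Rintegral integral_indic// setIT.
rewrite [X in fine X](@lebesgue_measure_itv R `[a, b])/=.
rewrite lte_fin; case: ltP => //= ba.
by apply/esym/eqP; rewrite subr_eq0 eq_le ab ba.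
Qed.

Lemma poisson_ge0 e u : 0 < e -> 0 <= poisson e u.
Proof.
move=> e0; rewrite divr_ge0 ?mulr_ge0 ?(ltW e0)//.
by rewrite addr_ge0 ?sqr_ge0.
Qed.

Lemma poisson_le e u : 0 < e -> poisson e u <= 2 / e.
Proof.
move=> e0; rewrite ler_pdivrMr ?sum_sqr_gt0// mulrDr.
by rewrite expr2 mulrA divfK ?gt_eqF// lerDl mulr_ge0 ?sqr_ge0// divr_ge0// ltW.
Qed.

Lemma continuous_poisson e : 0 < e -> continuous (poisson e).
Proof.
move=> e0 u; apply: cvgM; first exact: cvg_cst.
apply: cvgV; first by rewrite gt_eqF ?sum_sqr_gt0.
apply: cvgD; first exact: cvg_cst.
by rewrite expr2; under eq_fun do rewrite expr2; apply: cvgM; exact: cvg_id.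
Qed.

Lemma continuous_poisson_shift e t : 0 < e ->
  continuous (fun y => poisson e (t - y)).
Proof.
move=> e0 y; apply: (@continuous_comp _ _ _ (fun y => t - y) (poisson e)).
  by apply: cvgB; [exact: cvg_cst|exact: cvg_id].
exact: continuous_poisson.
Qed.

Lemma intg_seg_poisson a b t e : 0 < e ->
  intg mu (fun y => seg a b y * poisson e (t - y)).
Proof.
move=> e0; apply: (@intgM _ _ _ _ (2 / e)); first exact: intg_seg.
  by apply: continuous_measurable_fun; exact: continuous_poisson_shift.
by move=> x; rewrite ger0_norm ?poisson_ge0// poisson_le.
Qed.

Lemma Rintegral_seg_poisson a b t e : a < b -> 0 < e ->
  \int[mu]_y (seg a b y * poisson e (t - y)) =
  2 * (atan ((b - t) / e) - atan ((a - t) / e)).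
Proof.
move=> ab e0; pose F y : R := 2 * atan ((y - t) / e).
have dF y : is_derive y 1 F (poisson e (t - y)).
  rewrite /F; apply: is_derive_eq; rewrite /GRing.scale/= /poisson.
  have s0 : e ^+ 2 + (t - y) ^+ 2 != 0 by rewrite gt_eqF ?sum_sqr_gt0.
  have {}e0 : e != 0 by rewrite gt_eqF.
  by field; rewrite e0 s0.
have cF : continuous F.
  move=> y; apply: differentiable_continuous; apply/derivable1_diffP.
  by have [] := dF y.
have -> : \int[mu]_y (seg a b y * poisson e (t - y)) =
    \int[mu]_(y in `[a, b]) poisson e (t - y).
  rewrite [RHS]Rintegral_mkcond patch_indic.
  by apply: eq_Rintegral => y _ /=; rewrite mulrC.
rewrite /Rintegral (@continuous_FTC2 _ _ F)//.
- by rewrite -EFinB/= /F mulrBr.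
- by apply: continuous_subspaceT; exact: continuous_poisson_shift.
- split.
  + by move=> y _; have [] := dF y.
  + by apply: cvg_at_right_filter; exact: cF.
  + by apply: cvg_at_left_filter; exact: cF.
- by move=> y _; rewrite derive1E; have /@derive_val := dF y.
Qed.

Lemma abs_atan_le x : `|atan x| <= pi / 2.
Proof. by rewrite ler_norml !ltW// ?atan_gtNpi2 ?atan_ltpi2. Qed.

Lemma cvg_atan_mul x : 0 < x -> atan (x / k.+1%:R^-1) @[k --> \oo] --> pi / 2.
Proof.
move=> x0; under eq_fun do rewrite invrK.
have xr : atan (x * r) @[r --> +oo] --> pi / 2.
  apply: (cvg_comp (fun r : R => x * r) atan) (@cvgy_atan R).
  exact: gt0_cvgMry.
apply: (cvg_comp (fun k => k.+1%:R) (fun r : R => atan (x * r)) _ xr).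
rewrite (_ : (fun k => _) = (fun k => (k + 1)%:R : R)).
  by rewrite (cvg_shiftn 1); exact: cvgr_idn.
by apply/funext => k; rewrite addn1.
Qed.

(** The two arctangents tend to [pi / 2] or [- (pi / 2)] according to the side
    of [t] on which the end points lie, so they cancel unless [t] is between.
    *)
Lemma cvg_seg_poisson a b t : a < b -> t <> a -> t <> b ->
  2 * (atan ((b - t) / k.+1%:R^-1) - atan ((a - t) / k.+1%:R^-1))
    @[k --> \oo] --> 2 * pi * seg a b t.
Proof.
move=> ab /eqP ta /eqP tb; rewrite -mulrA.
apply: cvgM; first exact: cvg_cst.
have cvgN_atan (x : R) : x < 0 ->
    atan (x / k.+1%:R^-1) @[k --> \oo] --> - (pi / 2).
  move=> x0; rewrite (_ : (fun k => _) =
      (fun k : nat => - atan (- x / k.+1%:R^-1))); last first.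
    by apply/funext => k; rewrite mulNr atanN opprK.
  by apply: cvgN; apply: cvg_atan_mul; rewrite oppr_gt0.
have -> : pi * seg a b t =
    (if t < b then pi / 2 else - (pi / 2)) -
    (if t < a then pi / 2 else - (pi / 2)).
  rewrite segE (leNgt a t); have [ta'|at'] := ltP t a.
    by rewrite (lt_trans ta' ab) mulr0 subrr.
  by rewrite opprK /= le_eqVlt (negPf tb)/=; case: ltP => _;
    rewrite ?mulr0 ?addNr// mulr1 -splitr.
apply: cvgB.
  case: ltP => [tb'|bt']; first by apply: cvg_atan_mul; rewrite subr_gt0.
  by apply: cvgN_atan; rewrite subr_lt0 lt_neqAle eq_sym tb.
case: ltP => [ta'|at']; first by apply: cvg_atan_mul; rewrite subr_gt0.
by apply: cvgN_atan; rewrite subr_lt0 lt_neqAle eq_sym ta.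
Qed.

End PoissonOnSegments.

(** * Abel means of the inversion integral *)

Section AbelMeans.
Context {R : realType} {n : nat}.
Local Notation G := (clifford R (n + n)).
Notation mu := (@lebesgue_measure R).
Implicit Types (x t y : 'rV[R]_n) (C : {set 'I_(n + n)}) (e : R).

Definition abelrV e x : R := \prod_i abel e (x ord0 i).

Definition poissonrV e x : R := \prod_i poisson e (x ord0 i).

Lemma abelrV_ge0 e x : 0 <= abelrV e x.
Proof. by apply: prodr_ge0 => i _; exact: abel_ge0. Qed.

Lemma abelrV_le1 e x : 0 < e -> abelrV e x <= 1.
Proof.
by move=> e0; apply: prodr_ile1 => i _; rewrite abel_ge0 abel_le1.
Qed.

Lemma measurable_abelrV e : measurable_fun setT (abelrV e).
Proof.
apply: measurable_fprod => i.
exact: measurableT_comp (measurable_abel e) (measurable_coord i).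
Qed.

Lemma intg_abelrV e : 0 < e -> intg (lebesgue_rV n) (abelrV e).
Proof.
move=> e0.
by have [] := rV_prod_integral n (fun=> abel e) (fun=> intg_abel e e0).
Qed.

(** In the expansion of the rotor every term with a sine factor is odd in some
    coordinate, so only the product of the cosines survives integration against
    the even weight. *)
Lemma Rintegral_abelrV_rotor e (a : G) (u : 'I_n -> R) C : 0 < e ->
  \int[lebesgue_rV n]_x (abelrV e x * (a * rotor (fun i => u i * x ord0 i)) C)
  = (\prod_i poisson e (u i)) * a C.
Proof.
move=> e0; pose p (b : bool) (v : R) := if b then 0 else poisson e v.
have p_int b v : \int[mu]_x (abel e x * trig b (v * x)) = p b v.
  by case: b; [exact: Rintegral_abel_sin|exact: Rintegral_abel_cos].
have prodE x (s : {ffun 'I_n -> bool}) :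
    abelrV e x * \prod_i trig (s i) (u i * x ord0 i) =
    \prod_i (abel e (x ord0 i) * trig (s i) (u i * x ord0 i)).
  by rewrite big_split.
have prod_int (s : {ffun 'I_n -> bool}) :=
  rV_prod_integral n (fun i (r : R) => abel e r * trig (s i) (u i * r))
    (fun i => intg_abel_trig e (s i) (u i) e0).
(* Refold the constant as a sum over [s]: the terms with a sine vanish. *)
have -> : \prod_i poisson e (u i) * a C =
    \sum_(s : {ffun 'I_n -> bool}) (\prod_i p (s i) (u i)) * (a * bivecs s) C.
  transitivity ((a * \prod_i \sum_(b : bool)
      p b (u i) *: (if b then bivec i else 1 : G)) C).
    under [X in a * X]eq_bigr do rewrite big_bool/= scale0r add0r.
    by rewrite [X in a * X]scaler_prod big1_eq -scalerAr mulr1 clcoordZ.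
  rewrite bigA_distr_bigA mulr_sumr sum_ffunE; apply: eq_bigr => s _.
  by rewrite scaler_prod -scalerAr clcoordZ.
under eq_Rintegral do rewrite rotor_coord mulr_sumr.
rewrite Rintegral_fsum => [|s].
  apply: eq_bigr => s _; under eq_Rintegral do rewrite mulrA prodE.
  have [ip intp] := prod_int s.
  by rewrite RintegralZr// intp; under eq_bigr do rewrite p_int.
apply: (intg_eq _ (fun x => (a * bivecs s) C *
  \prod_i (abel e (x ord0 i) * trig (s i) (u i * x ord0 i)))).
  by move=> x; rewrite -prodE mulrC mulrA.
by apply: intgZ; have [] := prod_int s.
Qed.

Variable f : 'rV[R]_n -> G.
Hypothesis f_int : clintegrable f.

Definition shifted_kernel y x t : G :=
  f t * rotor (fun i => (t ord0 i - y ord0 i) * x ord0 i).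

(** The exponential in the outer transform is constant in [t], and combines with
    the inner one because rotors multiply by adding angles. *)
Lemma inv_transform_kernel y x :
  F2_integrand (inv_clifford_fourier f) (row_mx y 0) x =
  clint (shifted_kernel y x).
Proof.
rewrite /F2_integrand clexp_NIform2 row_mxKr.
have -> : dotrV x 0 = 0.
  by rewrite /dotrV big1// => i _; rewrite mxE mulr0.
rewrite oppr0 expR0 scale1r /inv_clifford_fourier -clint_mulr; last first.
  move=> C; apply: (intg_eq _ _ _ (fun t => esym (clmul_coord _ _ C))).
  apply: (clintegrable_sum_coord _ _ (2 ^+ n)) => // [A|A t].
    under eq_fun do rewrite clexp_Iform.
    apply: measurable_rotor_coord => i; apply: measurable_funM => //.
    exact: measurable_coord.
  by rewrite clexp_Iform (le_trans (rotor_coord_le _ _ _))// cl1_blade mul1r.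
congr clint; apply/funext => t; rewrite clexp_Iform -mulrA -rotorD.
congr (_ * rotor _); apply/funext => i.
by rewrite row_mxEl mulrBl [y _ _ * _]mulrC [t _ _ * _]mulrC.
Qed.

(** A common bound for all coordinates of [f t] times a rotor; [2 ^+ n] bounds
    the norm of a rotor. *)
Definition fnorm t : R := (\sum_A `|f t A|) * 2 ^+ n.

Lemma intg_fnorm : intg (lebesgue_rV n) fnorm.
Proof.
apply: (intg_eq _ _ _ (fun t => mulrC _ _)); apply: intgZ; apply: intg_sum => A.
by apply: intg_norm; apply: intg_lebesgue; exact: f_int.
Qed.

Lemma shifted_kernel_le y x t C : `|shifted_kernel y x t C| <= fnorm t.
Proof.
rewrite (le_trans (cl1_coord _ _))// (le_trans (cl1M _ _))//.
by rewrite ler_wpM2l ?cl1_ge0// cl1_rotor.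
Qed.

Lemma measurable_f_coord A : measurable_fun setT (fun t => f t A).
Proof. by apply: (intg_measurable dm); exact: f_int. Qed.

Lemma measurable_shifted_kernel d (T : measurableType d)
    (py px pt : T -> 'rV[R]_n) C :
  measurable_fun setT py -> measurable_fun setT px -> measurable_fun setT pt ->
  measurable_fun setT (fun z => shifted_kernel (py z) (px z) (pt z) C).
Proof.
move=> my mx mt; under eq_fun do rewrite clmul_coord.
apply: measurable_sum => A; apply: measurable_funM.
  exact: measurableT_comp (measurable_f_coord A) mt.
apply: measurable_rotor_coord => i; apply: measurable_funM.
  apply: measurable_funB.
    exact: measurableT_comp (measurable_coord i) mt.
  exact: measurableT_comp (measurable_coord i) my.
exact: measurableT_comp (measurable_coord i) mx.
Qed.

(** The weight makes the double integral absolutely convergent, so that the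
    integral over [x] can be taken first. *)
Lemma abel_mean_poisson e y C : 0 < e ->
  \int[dm]_x (abelrV e x *
    F2_integrand (inv_clifford_fourier f) (row_mx y 0) x C) =
  @dm_density R n * @dm_density R n *
    \int[lebesgue_rV n]_t (f t C * poissonrV e (t - y)).
Proof.
move=> e0.
have mker := measurable_shifted_kernel.
have icst x : intg (lebesgue_rV n) (fun t => shifted_kernel y x t C).
  apply: (@intg_le _ _ _ _ _ fnorm); last by move=> t; exact: shifted_kernel_le.
    by apply: mker => //; exact: measurable_cst.
  exact: intg_fnorm.
pose h (z : 'rV[R]_n * 'rV[R]_n) := abelrV e z.1 * shifted_kernel y z.1 z.2 C.
have hle z : `|h z| <= abelrV e z.1 * fnorm z.2.
  rewrite normrM ger0_norm ?abelrV_ge0// ler_wpM2l ?abelrV_ge0//.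
  exact: shifted_kernel_le.
have mh : measurable_fun setT h.
  apply: measurable_funM.
    exact: measurableT_comp (measurable_abelrV e) measurable_fst.
  apply: mker; first exact: measurable_cst.
    exact: measurable_fst.
  exact: measurable_snd.
have ih : intg (lebesgue_rV n \x lebesgue_rV n)%E h.
  apply: (@intg_le _ _ _ _ _ (fun z => abelrV e z.1 * fnorm z.2)) => //.
  exact: intg_prod_measure (intg_abelrV e e0) intg_fnorm.
have ih1 x : intg (lebesgue_rV n) (fun t => h (x, t)).
  exact: (intgZ _ (abelrV e x) _ (icst x)).
have ih2 t : intg (lebesgue_rV n) (fun x => h (x, t)).
  apply: (@intg_le _ _ _ _ _ (fun x => fnorm t * abelrV e x)).
  - exact: measurableT_comp mh (measurable_pair2 t).
  - exact: (intgZ _ (fnorm t) _ (intg_abelrV e e0)).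
  - by move=> x; rewrite mulrC hle.
have [iF intF] := Rintegral12_prod _ _ _ ih ih1.
have inner x : abelrV e x *
    F2_integrand (inv_clifford_fourier f) (row_mx y 0) x C =
    @dm_density R n * \int[lebesgue_rV n]_t h (x, t).
  rewrite inv_transform_kernel ffunE Rintegral_dm// mulrCA; congr (_ * _).
  by rewrite -RintegralZl//; exact: icst.
under eq_Rintegral do rewrite inner.
rewrite Rintegral_dm; last exact: intgZ.
rewrite RintegralZl// intF -Rintegral21_prod// mulrA; congr (_ * _).
apply: eq_Rintegral => t _; rewrite /h/= /shifted_kernel.
rewrite Rintegral_abelrV_rotor// mulrC; congr (_ * _).
by apply: eq_bigr => i _; rewrite !mxE.
Qed.

End AbelMeans.

(** * Comparison over boxes and Fourier inversion *)

Section BoxTest.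
Context {R : realType} {n : nat}.
Implicit Types (y v : 'rV[R]_n) (a b : 'I_n -> R).

Definition boxind a b y : R := \prod_i seg (a i) (b i) (y ord0 i).

Lemma boxind_ge0 a b y : 0 <= boxind a b y.
Proof. by apply: prodr_ge0 => i _; exact: seg_ge0. Qed.

Lemma measurable_boxind a b : measurable_fun setT (boxind a b).
Proof.
apply: measurable_fprod => i.
exact: measurableT_comp (measurable_seg _ _) (measurable_coord i).
Qed.

Lemma boxind_integral a b : (forall i, a i <= b i) ->
  intg (lebesgue_rV n) (boxind a b) /\
  \int[lebesgue_rV n]_y boxind a b y = \prod_i (b i - a i).
Proof.
move=> ab.
have [ibox intbox] := rV_prod_integral n (fun i => seg (a i) (b i))
  (fun i => intg_seg (a i) (b i)).
split=> //; rewrite [LHS]intbox; apply: eq_bigr => i _; exact: Rintegral_seg.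
Qed.

(** A positive value of [D] would make [D] bounded below by a positive constant
    on a small box, and the integral over this box positive. *)
Lemma le0_of_box_integrals (D : 'rV[R]_n -> R) : continuous D ->
  (forall a b, (forall i, a i < b i) ->
    intg (lebesgue_rV n) (fun y => boxind a b y * D y) /\
    \int[lebesgue_rV n]_y (boxind a b y * D y) = 0) ->
  forall y, D y <= 0.
Proof.
move=> cD D0 y; rewrite leNgt; apply/negP => Dy.
have Dy2 : 0 < D y / 2 by rewrite divr_gt0.
have /cvgrPdist_lt /(_ _ Dy2) := cD y.
move=> /nbhs_ballP[r /= r0]; rewrite -ball_normE/= => near_y.
pose a i := y ord0 i - r / 2; pose b i := y ord0 i + r / 2.
have r2 : 0 < r / 2 by rewrite divr_gt0.
have ab i : a i < b i by rewrite ltrD2l gtrN.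
have [iD intD] := D0 a b ab.
have [ibox intbox] := boxind_integral a b (fun i => ltW (ab i)).
have : D y / 2 * \prod_i (b i - a i) <= 0.
  rewrite -intD -intbox -RintegralZl//.
  apply: le_Rintegral => // [|v _]; first exact: intgZ.
  have [vQ|/forallPn[i vi]] := boolP [forall i, a i <= v ord0 i <= b i].
    rewrite mulrC ler_wpM2l ?boxind_ge0//.
    have : `|D y - D v| < D y / 2.
      apply: near_y => /=; rewrite (le_lt_trans _ (_ : r / 2 < r))//.
        rewrite [leLHS]/Num.Def.normr/= mx_normrE.
        apply: bigmax_le => [|[i j] _]; first exact: ltW.
        rewrite (ord1 i)/= !mxE ler_norml.
        have /forallP/(_ j) := vQ; rewrite /a /b => /andP[? ?].
        by apply/andP; split; lra.
      by rewrite ltr_pdivrMr// ltr_pMr// ltr1n.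
    rewrite ltr_norml => /andP[_ ?]; lra.
  by rewrite /boxind (bigD1 i)//= segE (negPf vi) !mul0r mulr0.
apply/negP; rewrite -ltNge mulr_gt0// prodr_gt0// => i _.
by rewrite subr_gt0.
Qed.

End BoxTest.

Section Inversion.
Context {R : realType} {n : nat}.
Local Notation G := (clifford R (n + n)).
Implicit Types (x t y : 'rV[R]_n) (C : {set 'I_(n + n)}).
Variable f : 'rV[R]_n -> G.
Hypothesis f_int : clintegrable f.
Hypothesis f_cont : continuous f.
Local Notation g := (inv_clifford_fourier f).
Hypothesis ig : expint g.

Let eps (k : nat) : R := k.+1%:R^-1.

Let eps_gt0 k : 0 < eps k. Proof. by rewrite invr_gt0. Qed.

Definition inv_integrand y x C : R := F2_integrand g (row_mx y 0) x C.

Definition abel_mean k y C : R :=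
  \int[dm]_x (abelrV (eps k) x * inv_integrand y x C).

Lemma clintegrable_g : clintegrable g.
Proof.
move=> C; apply: (intg_eq _ _ _ _ (ig (row_mx 0 0) C)) => x.
rewrite row_mxKr /dotrV big1 ?oppr0 ?expR0 ?scale1r// => i _.
by rewrite mxE mulr0.
Qed.

(** The bound does not depend on [y], so it dominates the Abel means uniformly
    over a box. *)
Lemma inv_integrand_le y x C : `|inv_integrand y x C| <= fnorm g x.
Proof.
rewrite /inv_integrand /F2_integrand clexp_NIform2 row_mxKr /dotrV big1.
  rewrite oppr0 expR0 scale1r (le_trans (cl1_coord _ _))//.
  by rewrite (le_trans (cl1M _ _))// ler_wpM2l ?cl1_ge0// cl1_rotor.
by move=> i _; rewrite mxE mulr0.
Qed.

Lemma intg_inv_integrand y C : intg dm (fun x => inv_integrand y x C).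
Proof. exact: F2_integrable. Qed.

Lemma cvg_abelrV x : abelrV (eps k) x @[k --> \oo] --> (1 : R).
Proof.
rewrite -[X in _ --> X](big1_eq (op := *%R) (idx := 1)
  (index_enum 'I_n) xpredT).
apply: cvg_fprod => i; rewrite -expR0 -oppr0 -(mul0r `|x ord0 i|).
apply: continuous_cvg; first exact: continuous_expR.
apply: cvgN; apply: cvgM; last exact: cvg_cst.
exact: cvg_harmonic.
Qed.

Lemma cvg_abel_mean y C :
  abel_mean k y C @[k --> \oo] --> F2 g (row_mx y 0) C.
Proof.
rewrite /F2 ffunE; apply: (proj2 (Rintegral_dct dm
  (fun k x => abelrV (eps k) x * inv_integrand y x C) _
  (fun x => `|inv_integrand y x C|) _ _ _ _)).
- move=> k; apply: measurable_funM; first exact: measurable_abelrV.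
  by apply: (intg_measurable dm); exact: intg_inv_integrand.
- by apply: intg_norm; exact: intg_inv_integrand.
- move=> k x; rewrite normrM ler_piMl// ger0_norm ?abelrV_ge0//.
  exact: abelrV_le1.
- move=> x; rewrite -[X in _ --> X]mul1r.
  by apply: cvgM; [exact: cvg_abelrV|exact: cvg_cst].
Qed.

Lemma abel_mean_le k y C : `|abel_mean k y C| <= \int[dm]_x fnorm g x.
Proof.
have iu : intg dm (fun x => abelrV (eps k) x * inv_integrand y x C).
  apply: (@intg_le _ _ _ _ _ (fun x => `|inv_integrand y x C|)).
  - apply: measurable_funM; first exact: measurable_abelrV.
    by apply: (intg_measurable dm); exact: intg_inv_integrand.
  - by apply: intg_norm; exact: intg_inv_integrand.
  - move=> x; rewrite normrM ler_piMl// ger0_norm ?abelrV_ge0//.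
    exact: abelrV_le1.
rewrite (le_trans (le_normr_Rintegral _ iu))//; apply: le_Rintegral => //.
- exact: intg_norm.
- by apply: intg_dm; apply: intg_fnorm; exact: clintegrable_g.
- move=> x _; rewrite normrM (le_trans _ (inv_integrand_le y x C))//.
  by rewrite ler_piMl// ger0_norm ?abelrV_ge0// abelrV_le1.
Qed.

Section Box.
Variables a b : 'I_n -> R.
Hypothesis ab : forall i, a i < b i.

Let kernel k t : R := \prod_i (2 * (atan ((b i - t ord0 i) / eps k) -
                                    atan ((a i - t ord0 i) / eps k))).

(** Fubini's theorem in [y] and [t]: the box average passes from the Poisson
    kernel to its segment averages, one coordinate at a time. *)
Let box_mean_aux k C :
  intg (lebesgue_rV n) (fun y => boxind a b y * abel_mean k y C) /\
  \int[lebesgue_rV n]_y (boxind a b y * abel_mean k y C) =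
  @dm_density R n * @dm_density R n *
    \int[lebesgue_rV n]_t (f t C * kernel k t).
Proof.
pose e := eps k; have e0 : 0 < e := eps_gt0 k.
have [ibox _] := boxind_integral a b (fun i => ltW (ab i)).
have ifC : intg (lebesgue_rV n) (fun t => f t C).
  by apply: intg_lebesgue; exact: f_int.
pose h (z : 'rV[R]_n * 'rV[R]_n) :=
  boxind a b z.1 * (f z.2 C * poissonrV e (z.2 - z.1)).
have pge0 t : 0 <= poissonrV e t by apply: prodr_ge0 => i _; exact: poisson_ge0.
have ple t : poissonrV e t <= (2 / e) ^+ n.
  rewrite (_ : (2 / e) ^+ n = \prod_(i < n) (2 / e)); last first.
    by rewrite prodr_const card_ord.
  by apply: ler_prod => i _; rewrite poisson_ge0// poisson_le.
have mpoisson : measurable_fun setT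
    (fun z : 'rV[R]_n * 'rV[R]_n => poissonrV e (z.2 - z.1)).
  apply: measurable_fprod => i.
  apply: (measurableT_comp (f := poisson e)) => /=.
    by apply: continuous_measurable_fun; exact: continuous_poisson.
  under eq_fun do rewrite !mxE.
  apply: measurable_funB.
    exact: measurableT_comp (measurable_coord i) measurable_snd.
  exact: measurableT_comp (measurable_coord i) measurable_fst.
have mfC : measurable_fun setT (fun t => f t C) by exact: intg_measurable ifC.
have mh : measurable_fun setT h.
  apply: measurable_funM.
    exact: measurableT_comp (measurable_boxind a b) measurable_fst.
  by apply: measurable_funM => //; exact: measurableT_comp mfC measurable_snd.
pose F t := (2 / e) ^+ n * `|f t C|.
have iF : intg (lebesgue_rV n) F by apply: intgZ; exact: intg_norm.
have hle z : `|h z| <= boxind a b z.1 * F z.2.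
  rewrite normrM ger0_norm ?boxind_ge0// ler_wpM2l ?boxind_ge0//.
  by rewrite normrM mulrC ler_wpM2r// ger0_norm.
have ih : intg (lebesgue_rV n \x lebesgue_rV n)%E h.
  apply: (@intg_le _ _ _ _ _ (fun z => boxind a b z.1 * F z.2)) => //.
  exact: intg_prod_measure ibox iF.
have ih1 y : intg (lebesgue_rV n) (fun t => h (y, t)).
  apply: (@intg_le _ _ _ _ _ (fun t => boxind a b y * F t)).
  - exact: measurableT_comp mh (measurable_pair1 y).
  - exact: intgZ.
  - by move=> t; exact: hle (y, t).
have ih2 t : intg (lebesgue_rV n) (fun y => h (y, t)).
  apply: (@intg_le _ _ _ _ _ (fun y => F t * boxind a b y)).
  - exact: measurableT_comp mh (measurable_pair2 t).
  - exact: intgZ.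
  - by move=> y; rewrite mulrC; exact: hle (y, t).
have [iM intM] := Rintegral12_prod _ _ _ ih ih1.
have meanE y : boxind a b y * abel_mean k y C =
    @dm_density R n * @dm_density R n * \int[lebesgue_rV n]_t h (y, t).
  rewrite /abel_mean /inv_integrand abel_mean_poisson// mulrCA; congr (_ * _).
  rewrite -RintegralZl//; apply: (@intgM _ _ _ _ ((2 / e) ^+ n)) => // [|t].
    exact: measurableT_comp mpoisson (measurable_pair1 y).
  by rewrite ger0_norm.
split.
  by apply: (intg_eq _ _ _ (fun y => esym (meanE y))); exact: intgZ.
under eq_Rintegral do rewrite meanE.
rewrite RintegralZl// intM -Rintegral21_prod//; congr (_ * _).
apply: eq_Rintegral => t _.
have [ik intk] := rV_prod_integral n
  (fun i (r : R) => seg (a i) (b i) r * poisson e (t ord0 i - r))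
  (fun i => intg_seg_poisson (a i) (b i) (t ord0 i) e e0).
have hE y : h (y, t) = f t C * \prod_i (seg (a i) (b i) (y ord0 i) *
    poisson e (t ord0 i - y ord0 i)).
  rewrite /h/= mulrCA big_split; congr (_ * (_ * _)).
  by apply: eq_bigr => i _; rewrite !mxE.
under eq_Rintegral do rewrite hE.
rewrite RintegralZl// intk; congr (_ * _).
by apply: eq_bigr => i _; rewrite Rintegral_seg_poisson.
Qed.

(** The limit of the box integrals of the Abel means is found twice, by
    dominated convergence in [y] on one side and in the arctangent kernels on
    the other; the normalization of [dm] compensates the factors [2 * pi]. *)
Lemma box_mean_inversion C :
  [/\ intg (lebesgue_rV n) (fun y => boxind a b y * F2 g (row_mx y 0) C),
      intg (lebesgue_rV n) (fun y => boxind a b y * f y C) &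
      \int[lebesgue_rV n]_y (boxind a b y * F2 g (row_mx y 0) C) =
      \int[lebesgue_rV n]_y (boxind a b y * f y C)].
Proof.
have [ibox _] := boxind_integral a b (fun i => ltW (ab i)).
have ifC : intg (lebesgue_rV n) (fun t => f t C).
  by apply: intg_lebesgue; exact: f_int.
have mean_le k y : `|boxind a b y * abel_mean k y C| <=
    (\int[dm]_x fnorm g x) * boxind a b y.
  rewrite normrM ger0_norm ?boxind_ge0// mulrC ler_wpM2r ?boxind_ge0//.
  exact: abel_mean_le.
have [iF limF] := Rintegral_dct (lebesgue_rV n)
  (fun k y => boxind a b y * abel_mean k y C)
  (fun y => boxind a b y * F2 g (row_mx y 0) C)
  (fun y => (\int[dm]_x fnorm g x) * boxind a b y)
  (fun k => intg_measurable _ _ (proj1 (box_mean_aux k C)))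
  (intgZ _ _ _ ibox)
  mean_le
  (fun y => cvgM (cvg_cst _) (cvg_abel_mean y C)).
have kernel_le k t : `|kernel k t| <= (2 * pi) ^+ n.
  rewrite /kernel normr_prod.
  rewrite (_ : (2 * pi) ^+ n = \prod_(i < n) (2 * pi)); last first.
    by rewrite prodr_const card_ord.
  apply: ler_prod => i _; rewrite normr_ge0/= normrM gtr0_norm// ler_wpM2l//.
  rewrite (le_trans (ler_normB _ _))// [leRHS]splitr.
  by apply: lerD; exact: abs_atan_le.
have mkernel k : measurable_fun setT (kernel k).
  apply: measurable_fprod => i; apply: measurable_funM => //.
  have matan (c : R) : measurable_fun setT
      (fun t => atan ((c - t ord0 i) / eps k)).
    apply: measurableT_comp.
      by apply: continuous_measurable_fun; exact: continuous_atan.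
    apply: measurable_funM => //; apply: measurable_funB => //.
    exact: measurable_coord.
  by apply: measurable_funB; exact: matan.
have ilim : intg (lebesgue_rV n) (fun t => f t C * boxind a b t).
  apply: (@intgM _ _ _ _ 1) => // [|t]; first exact: measurable_boxind.
  rewrite ger0_norm ?boxind_ge0//; apply: prodr_ile1 => i _.
  by rewrite seg_ge0 seg_le1.
have kernel_cvg : {ae lebesgue_rV n, forall t : 'rV[R]_n,
    f t C * kernel k t @[k --> \oo] --> (2 * pi) ^+ n * (f t C * boxind a b t)}.
  have ta : {ae lebesgue_rV n, forall t : 'rV[R]_n, forall i, t ord0 i <> a i}.
    by apply: filter_forall => i; exact: ae_coord_neq.
  have tb : {ae lebesgue_rV n, forall t : 'rV[R]_n, forall i, t ord0 i <> b i}.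
    by apply: filter_forall => i; exact: ae_coord_neq.
  apply: filterS2 ta tb => t ta tb; rewrite /= mulrCA.
  apply: cvgM; first exact: cvg_cst.
  rewrite (_ : (2 * pi) ^+ n = \prod_(i < n) (2 * pi)); last first.
    by rewrite prodr_const card_ord.
  rewrite -big_split; apply: cvg_fprod => i.
  exact: cvg_seg_poisson.
have dom k t : `|f t C * kernel k t| <= (2 * pi) ^+ n * `|f t C|.
  by rewrite normrM mulrC ler_wpM2r.
have [_ limK] := Rintegral_dct_ae (lebesgue_rV n)
  (fun k t => f t C * kernel k t)
  (fun t => (2 * pi) ^+ n * (f t C * boxind a b t))
  (fun t => (2 * pi) ^+ n * `|f t C|)
  (fun k => measurable_funM (intg_measurable _ _ ifC) (mkernel k))
  (intg_measurable _ _ (intgZ _ _ _ ilim))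
  (intgZ _ _ _ (intg_norm _ _ ifC))
  dom kernel_cvg.
have fboxE : \int[lebesgue_rV n]_y (boxind a b y * f y C) =
    \int[lebesgue_rV n]_y (f y C * boxind a b y).
  by apply: eq_Rintegral => y _; rewrite mulrC.
split=> //; first by apply: (intg_eq _ _ _ _ ilim) => y; rewrite mulrC.
have limE : \int[lebesgue_rV n]_y (boxind a b y * abel_mean k y C) @[k --> \oo]
    --> @dm_density R n * @dm_density R n *
    \int[lebesgue_rV n]_t ((2 * pi) ^+ n * (f t C * boxind a b t)).
  under eq_fun => k do rewrite (proj2 (box_mean_aux k C)).
  by apply: cvgM; [exact: cvg_cst|exact: limK].
rewrite fboxE (cvg_unique _ limF limE)//.
by rewrite RintegralZl// mulrA dm_density_sqr mul1r.
Qed.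

End Box.

Lemma continuous_row_mx0 : continuous (fun y => row_mx y 0 : 'rV[R]_(n + n)).
Proof.
move=> y; apply/(@cvgrPdist_lt _ _ _ _ (nbhs_filter y)) => e e0.
apply/nbhs_ballP; exists e => //= v; rewrite -ball_normE/= => yv.
rewrite (le_lt_trans _ yv)// [leLHS]/Num.Def.normr/= mx_normrE.
apply: bigmax_le => // -[i j] _; rewrite (ord1 i)/= !mxE.
case: split_ordP => l _; first by have := rV_coord_le _ (y - v) l; rewrite !mxE.
by rewrite mxE subrr normr0.
Qed.

Lemma F2_inversion y : F2 g (row_mx y 0) = f y.
Proof.
have cF C : continuous (fun y => F2 g (row_mx y 0) C).
  move=> z.
  have /(@clcvgP _ _ _ _ (nbhs_filter _)) /(_ C) :=
    continuous_F2 g ig (row_mx z 0).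
  exact: (cvg_comp (fun y => row_mx y 0) (fun w => F2 g w C)
    (@continuous_row_mx0 z)).
have cf C : continuous (fun y => f y C).
  by move=> z; have /(@clcvgP _ _ _ _ (nbhs_filter _)) := f_cont z; exact.
(* The signs [c = 1] and [c = - 1] give the two inequalities. *)
have le0 C (c : R) : c * (F2 g (row_mx y 0) C - f y C) <= 0.
  apply: (le0_of_box_integrals (fun y => c * (F2 g (row_mx y 0) C - f y C))).
    move=> z; have Fz := nbhs_filter z; apply: (@cvgM _ _ _ Fz).
      exact: (@cvg_cst _ _ _ _ Fz).
    by apply: (@cvgB _ _ _ _ Fz); [exact: cF|exact: cf].
  move=> a b ab; have [iF if_ FE] := box_mean_inversion a b ab C.
  have dE v : c * (boxind a b v * F2 g (row_mx v 0) C - boxind a b v * f v C) =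
      boxind a b v * (c * (F2 g (row_mx v 0) C - f v C)).
    by rewrite -mulrBr mulrCA.
  have iD := intgB _ _ _ iF if_.
  split; first by apply: (intg_eq _ _ _ dE); exact: intgZ.
  under eq_Rintegral do rewrite -dE.
  by rewrite RintegralZl// RintegralB// FE subrr mulr0.
apply/ffunP => C; apply/eqP; rewrite eq_le; apply/andP; split.
  by have := le0 C 1; rewrite mul1r subr_le0.
by have := le0 C (- 1); rewrite mulN1r oppr_le0 subr_ge0.
Qed.

End Inversion.

Theorem theorem4p2 (R : realType) (n : nat)
    (f : 'rV[R]_n -> clifford R (n + n))
    (f_cont : continuous f)
    (f_int : clintegrable f)
    (g_int : clintegrable (inv_clifford_fourier f))
    (g_exp_int : forall y : 'rV[R]_(n + n),
      clintegrable (fun x : 'rV[R]_n =>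
        expR (- dotrV x (rsubmx y)) *: inv_clifford_fourier f x))
    (g_coord_exp_int : forall (y : 'rV[R]_(n + n)) (i : 'I_n),
      clintegrable (fun x : 'rV[R]_n =>
        (x ord0 i * expR (- dotrV x (rsubmx y))) *: inv_clifford_fourier f x)) :
  [/\ forall y : 'rV[R]_(n + n),
        clintegrable (F2_integrand (inv_clifford_fourier f) y),
      right_monogenic setT (F2 (inv_clifford_fourier f)) &
      forall x : 'rV[R]_n, F2 (inv_clifford_fourier f) (row_mx x 0) = f x].
Proof.
have coord_int i : expint (coordmul i (inv_clifford_fourier f)).
  move=> y C; apply: (intg_eq _ _ _ _ (g_coord_exp_int y i C)) => x.
  by rewrite scalerA [expR _ * _]mulrC.
split.
- by move=> y; exact: F2_integrable.
- exact: right_monogenic_F2.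
- exact: F2_inversion.
Qed.
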